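(* As $x\to\infty$, $$\#\left(\mathcal{S}_x\cap(0,M(x)]\right)=(1+o(1))\frac{M(x)}{2^{\pi(x)+1}e^{\gamma}\log x}.$$
   Context: For a real number $x$, $M(x)$ denotes the product of all primes $p\le x$, $\pi(x)$ is the number of primes $p\le x$, and $\gamma$ is the Euler–Mascheroni constant. An $x$-pseudosquare is a positive integer $n$ that is not a perfect square, satisfies $n\equiv 1\pmod 8$, and satisfies $\left(\frac{n}{p}\right)=1$ (Legendre symbol) for each odd prime $p\le x$. $\mathcal{S}_x$ denotes the set of all $x$-pseudosquares. *)

(* Defs.v *)
From mathcomp Require Import all_boot all_order all_algebra.
From mathcomp Require Import finmap.
From mathcomp Require Import all_classical all_reals all_analysis.
Set Implicit Arguments.
Unset Strict Implicit.
Unset Printing Implicit Defensive.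
Import Order.TTheory GRing.Theory Num.Theory.
Import numFieldNormedType.Exports.
Local Open Scope classical_set_scope.
Local Open Scope ring_scope.

(* Num.truncn x is floor x for 0 <= x and 0 for x < 0. *)
Definition primes_le (R : realType) (x : R) : seq nat :=
  [seq p <- iota 0 (Num.truncn x).+1 | prime p].

Lemma mem_primes_le (R : realType) (x : R) (p : nat) :
  (p \in primes_le x) = prime p && (p%:R <= x).
Proof.
rewrite mem_filter mem_iota add0n ltnS /=; case pp: (prime p) => //=.
by case: p pp => // p _; rewrite truncn_gt_nat.
Qed.

Definition prime_pi (R : realType) (x : R) : nat := size (primes_le x).

Definition primorial (R : realType) (x : R) : nat :=
  (\prod_(p <- primes_le x) p)%N.

Definition legendre (a p : nat) : int :=
  if (p %| a)%N then 0
  else if [exists b : 'I_p, (b ^ 2 == a %[mod p])%N] then 1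
  else -1.

Definition pseudosquares (R : realType) (x : R) : set nat :=
  [set n | [/\ (0 < n)%N, ~ (exists m : nat, n = (m ^ 2)%N), (n = 1 %[mod 8])%N
    & forall p : nat, prime p -> odd p -> p%:R <= x -> legendre n p = 1]].

Definition euler_gamma (R : realType) : R :=
  limn (fun n : nat => (\sum_(1 <= k < n.+1) k%:R^-1) - ln n%:R).

(* Main.v *)
Require Import Defs.
From mathcomp Require Import all_boot all_order all_algebra.
From mathcomp Require Import finmap.
From mathcomp Require Import all_classical all_reals all_analysis.
From mathcomp Require Import zify ring lra.
Import Order.TTheory GRing.Theory Num.Theory.
Import numFieldNormedType.Exports.

(** Write M for the primorial of x and pi for the number of primes up to x.

    Counting.  A pseudosquare n <= M is some 1 + 8 m, with m < M / 8 up to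
    rounding, at which every factor 1 - [p | n] + (n/p), p odd, of [qr_weight]
    is 2 and not 0; the squares among these n are too few to matter.  Expanding
    the product ([qr_weight_sum]), the terms without a character give
    M / 8 times the product of the 1 - 1/p over odd p <= x, and the others are
    at most 4^pi incomplete sums of Jacobi symbols along progressions whose
    difference is prime to the modulus.  Such a sum is treated in
    [incomplete_sum_le] by smoothing: averaging it over J shifts and applying
     Cauchy-Schwarz over a full period d leaves complete correlation
    sums, which factor over the primes of d and are evaluated by counting
    solutions of u v = h modulo p.  The resulting bound 2 J + d / A, where J and
    A may be taken exponential in pi, suffices because M exceeds a constant times
    C^pi for every fixed C ([exp_size_O_primorial]).  Hence the count is
    M / 2^(pi+1) times the product of the 1 - 1/p over all p <= x, with relative
    error O(2^-pi) ([pseudosquare_count_estimate]).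

    Mertens' product ([mertens_product]).  For s >= 0 put the mass
    - ln (1 - p^(-1-s)) on each prime of the block (2^k, 2^(k+1)] and compare the
    block with the mass 2^(-sk) / k.  Since the sum of ln p / p over p <= 2^K is
    K ln 2 + O(1), partial summation shows that the difference of the two masses
    beyond K is O(1/K), uniformly in s ([euler_log_dyadic_tail]).  For s > 0 both
    total masses are explicit, ln zeta(1+s) and - ln (1 - 2^(-s)), and
    zeta(1+s) (1 - 2^(-s)) tends to ln 2 as s tends to 0.  So at s = 0 the sum of
    - ln (1 - 1/p) over p <= 2^K differs from the harmonic number of index K - 1
    by ln ln 2 + O(1/K) ([mertens_gap0_bound]), and Euler's constant enters
    only as the limit of the harmonic numbers minus ln K. *)

Set Implicit Arguments.
Unset Strict Implicit.
Unset Printing Implicit Defensive.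
Local Open Scope ring_scope.

(** * Sums over residue classes *)

(** The upper bound on the right is the exact number of k < K in the class of r
    modulo p; [count_residue_class] compares it with K / p. *)
Lemma sum_residue_class (V : nmodType) (p r K : nat) (g : nat -> V) :
  (r < p)%N ->
  \sum_(k < K | (k %% p == r)%N) g k =
  \sum_(k < (K + (p.-1 - r)) %/ p) g (r + p * k)%N.
Proof.
move=> rp; have p0 : (0 < p)%N by exact: leq_ltn_trans rp.
elim: K => [|K IH].
  by rewrite big_ord0 divn_small ?big_ord0 //; lia.
rewrite big_mkcond big_ord_recr /= -big_mkcond IH.
have tp : (K %% p < p)%N by rewrite ltn_mod.
have dE u v : (v < p)%N -> ((u * p + v) %/ p = u)%N.
  by move=> vp; rewrite divnMDl // divn_small // addn0.
set q := (K %/ p)%N; set t := (K %% p)%N in tp *.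
have KE : K = (q * p + t)%N by exact: divn_eq.
have e1 : (t <= r)%N -> ((K + (p.-1 - r)) %/ p = q)%N.
  by move=> tr; rewrite {1}KE -addnA dE //; lia.
have e2 : (r < t)%N -> ((K + (p.-1 - r)) %/ p = q.+1)%N.
  move=> tr; have -> : (K + (p.-1 - r) = q.+1 * p + (t - r.+1))%N by lia.
  by rewrite dE //; lia.
have e3 : (t < r)%N -> ((K.+1 + (p.-1 - r)) %/ p = q)%N.
  move=> tr; have -> : (K.+1 + (p.-1 - r) = q * p + (t.+1 + (p.-1 - r)))%N by lia.
  by rewrite dE //; lia.
have e4 : (r <= t)%N -> ((K.+1 + (p.-1 - r)) %/ p = q.+1)%N.
  move=> tr; have -> : (K.+1 + (p.-1 - r) = q.+1 * p + (t - r))%N by lia.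
  by rewrite dE //; lia.
case: (ltngtP t r) => tr.
- by rewrite addr0 e1 ?e3 // ltnW.
- by rewrite addr0 e2 ?e4 // ltnW.
- by rewrite e1 ?e4 ?tr // big_ord_recr /= KE tr addnC mulnC.
Qed.

(** An inverse of b modulo p turns divisibility along a progression into a
    residue class of the index. *)
Lemma dvd_progression (p a b : nat) : prime p -> coprime p b ->
  exists2 r, (r < p)%N & forall k, (p %| a + b * k)%N = (k %% p == r)%N.
Proof.
move=> pp cpb; have p0 := prime_gt0 pp.
have [[u v] /= huv] := coprimeP b p0 cpb.
have hk0 : (p %| a + b * (a * v))%N.
  have -> : (a + b * (a * v) = a * u * p)%N by nia.
  exact: dvdn_mull.
exists ((a * v) %% p)%N => [|k]; first by rewrite ltn_mod.
move/eqP: hk0 => hk0; have -> : (p %| a + b * k)%N = (a + b * k == a + b * (a * v) %[mod p])%N by rewrite hk0.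
rewrite eqn_modDl.
move: (a * v)%N => k0 {hk0}.
wlog le0 : k k0 / (k0 <= k)%N => [W|].
  have [/W //|/ltnW/W e] := leqP k0 k; by rewrite eq_sym e eq_sym.
by rewrite eqn_mod_dvd ?leq_mul2l ?le0 ?orbT // -mulnBr Gauss_dvdr // -eqn_mod_dvd.
Qed.

Lemma count_residue_class (R : realFieldType) (p r K : nat) : (r < p)%N ->
  `|((K + (p.-1 - r)) %/ p)%:R - K%:R / p%:R| <= 1 :> R.
Proof.
move=> rp; have p0 : (0 < p)%N by exact: leq_ltn_trans rp.
have pR : 0 < p%:R :> R by rewrite ltr0n.
set q := (_ %/ p)%N.
have h1 : (q * p <= K + p)%N by have := leq_divM (K + (p.-1 - r)) p; rewrite -/q; lia.
have h2 : (K <= q * p + p)%N.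
  by have := ltn_ceil (K + (p.-1 - r)) p0; rewrite -/q; lia.
move: h1 h2; rewrite -!(ler_nat R) !natrD !natrM.
have : K%:R = K%:R / p%:R * p%:R :> R by rewrite divfK // gt_eqF.
move: (K%:R / p%:R) => z -> h1 h2.
by rewrite ler_norml; apply/andP; split; rewrite -(ler_pM2r pR) mulrBl; lra.
Qed.

(** The Chinese remainder bijection between residues modulo m n and pairs of
    residues. *)
Lemma big_mod_prod (R : comPzRingType) (m n : nat) (g u : nat -> R) :
  (0 < m)%N -> (0 < n)%N -> coprime m n ->
  (forall k, g (k %% m)%N = g k) -> (forall k, u (k %% n)%N = u k) ->
  \sum_(k < m * n) g k * u k = (\sum_(k < m) g k) * (\sum_(k < n) u k).
Proof.
move=> m0 n0 cmn gm un.
rewrite big_distrlr /= pair_big /=.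
pose h (k : 'I_(m * n)) : 'I_m * 'I_n :=
  (Ordinal (ltn_pmod k m0), Ordinal (ltn_pmod k n0)).
have hinj : injective h.
  move=> x y [/eqP h1 /eqP h2]; apply/val_inj => /=.
  have : (x == y %[mod m * n])%N by rewrite chinese_remainder // h1 h2.
  by rewrite !modn_small // => /eqP.
have hbij : bijective h.
  by apply: inj_card_bij => //; rewrite card_prod !card_ord.
rewrite (reindex h) /=; last exact: onW_bij.
by apply: eq_bigr => k _; rewrite gm un.
Qed.

(** * Correlations of a Legendre symbol *)

Definition sqrt_count (p : nat) (x : 'F_p) : nat := #|[set y : 'F_p | y ^+ 2 == x]|.

Lemma eq_Fp_nat (p m n : nat) : prime p ->
  ((m%:R : 'F_p) == n%:R) = (m == n %[mod p])%N.
Proof. by move=> pp; rewrite -val_eqE /= !val_Fp_nat. Qed.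

Lemma Fp_two_neq0 (p : nat) : prime p -> odd p -> (2%:R : 'F_p) != 0.
Proof.
move=> pp op; rewrite -[0]/(0%:R) eq_Fp_nat // mod0n.
by have := prime_gt1 pp; case: p op {pp} => [|[|[|p]]].
Qed.

(** Expressing the symbol by a number of square roots turns sums of products of
    symbols into counts of points. *)
Lemma legendre_sqrt_count (n p : nat) : prime p -> odd p ->
  legendre n p = (sqrt_count (n%:R : 'F_p))%:R - 1.
Proof.
move=> pp op; rewrite natz /legendre /sqrt_count.
have n0 : ((n%:R : 'F_p) == 0) = (p %| n)%N.
  by rewrite -[0]/(0%:R) eq_Fp_nat // mod0n.
case: ifP => [pn|pn].
  move: n0; rewrite pn => /eqP ->.
  have -> : [set y : 'F_p | y ^+ 2 == 0] = [set 0].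
    by apply/setP => y; rewrite !inE expf_eq0.
  by rewrite cards1.
case: ifP => [/existsP[b hb]|hb].
  have hb' : (n%:R : 'F_p) = (b : nat)%:R ^+ 2.
    by apply/eqP; rewrite eq_sym -natrX eq_Fp_nat.
  set y0 : 'F_p := (b : nat)%:R in hb'.
  have -> : [set y : 'F_p | y ^+ 2 == n%:R] = [set y0; - y0].
    by apply/setP => y; rewrite !inE hb' eqf_sqr.
  rewrite cards2; case: eqP => // e.
  have : y0 * 2%:R == 0 by rewrite mulr_natr mulr2n {2}e subrr.
  rewrite mulf_eq0 (negbTE (Fp_two_neq0 pp op)) orbF => /eqP y00.
  by move: n0; rewrite hb' y00 expr0n eqxx pn.
have -> : [set y : 'F_p | y ^+ 2 == n%:R] = finset.set0.
  apply/setP => y; rewrite !inE; apply/negP => /eqP hy.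
  move/negbT/existsPn: hb => hb.
  have yp : (y < p)%N by rewrite -{2}(Fp_cast pp) ltn_ord.
  have /negP := hb (Ordinal yp); apply => /=.
  by rewrite -eq_Fp_nat // natrX natr_Zp hy.
by rewrite cards0.
Qed.

Lemma sum_Fp_nat (V : nmodType) (p : nat) (F : 'F_p -> V) : prime p ->
  \sum_(k < p) F (k : nat)%:R = \sum_(x : 'F_p) F x.
Proof.
move=> pp; rewrite -(big_mkord xpredT (fun k => F k%:R)) -{1}(Fp_cast pp) big_mkord.
by apply: eq_bigr => k _; rewrite natr_Zp.
Qed.

Lemma sqrt_countE (p : nat) (x : 'F_p) :
  sqrt_count x = (\sum_(y : 'F_p | y ^+ 2 == x) 1)%N.
Proof. by rewrite /sqrt_count -sum1_card; apply: eq_bigl => y; rewrite inE. Qed.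

Lemma sum_sqrt_count (p : nat) : prime p -> (\sum_(x : 'F_p) sqrt_count x = p)%N.
Proof.
move=> pp; rewrite (eq_bigr _ (fun x _ => sqrt_countE x)).
rewrite (exchange_big_dep xpredT) //=.
under eq_bigr => y _ do rewrite (big_pred1 (y ^+ 2)) //.
by rewrite sum1_card card_Fp.
Qed.

(** The left side counts the solutions of z^2 - y^2 = h.  Since 2 is invertible,
    (y, z) -> (z - y, z + y) carries them to the solutions of u v = h: one for
    each u <> 0, and p more with u = 0 when h = 0. *)
Lemma sum_sqrt_count_shift (p : nat) (h : 'F_p) : prime p -> odd p ->
  (\sum_(x : 'F_p) sqrt_count x * sqrt_count (x + h)%R = p.-1 + (h == 0%R) * p)%N.
Proof.
move=> pp op.
transitivity (\sum_(u : 'F_p * 'F_p | (u.1 * u.2 == h)%R) 1)%N.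
  pose f (u : 'F_p * 'F_p) := (u.2 - u.1, u.2 + u.1)%R.
  have finj : injective f.
    move=> [y z] [y' z'] e.
    have e1 : (z - y = z' - y')%R := congr1 fst e.
    have e2 : (z + y = z' + y')%R := congr1 snd e.
    have dbl (s t : 'F_p) : (s * 2%:R = (s - t) + (s + t))%R by ring.
    have ez : z = z'.
      by apply: (mulIf (Fp_two_neq0 pp op)); rewrite (dbl z y) (dbl z' y') e1 e2.
    by move: e2; rewrite ez => /addrI ->.
  rewrite (reindex f); last exact/onW_bij/injF_bij.
  rewrite (eq_bigl (fun u => (u.2 ^+ 2 == u.1 ^+ 2 + h)%R)); last first.
    by move=> [y z] /=; rewrite -subr_sqr subr_eq addrC.
  transitivity (\sum_(x : 'F_p) \sum_(y : 'F_p | (y ^+ 2 == x)%R)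
                  \sum_(z : 'F_p | (z ^+ 2 == x + h)%R) 1)%N.
    by apply: eq_bigr => x _; rewrite !sqrt_countE big_distrlr.
  rewrite (exchange_big_dep xpredT) //=.
  transitivity (\sum_(y : 'F_p) \sum_(z : 'F_p | (z ^+ 2 == y ^+ 2 + h)%R) 1)%N.
    by apply: eq_bigr => y _; rewrite (big_pred1 (y ^+ 2)%R).
  by rewrite pair_big_dep.
transitivity (\sum_(u : 'F_p) \sum_(v : 'F_p | (u * v == h)%R) 1)%N.
  by rewrite pair_big_dep.
rewrite (bigD1 0%R) //= addnC; congr (_ + _)%N.
  rewrite (eq_bigr (fun=> 1%N)); last first.
    move=> u u0; rewrite (big_pred1 (u^-1 * h)%R) // => v /=.
    by rewrite -[RHS](inj_eq (mulfI u0)) mulVKf.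
  rewrite sum1_card cardC1 card_Fp //.
rewrite sum1_card; case: eqP => [->|/eqP h0].
  by rewrite mul1n -[RHS](card_Fp pp); apply: eq_card => v; rewrite unfold_in mul0r.
by apply: eq_card0 => v; rewrite unfold_in mul0r; apply/negP => /eqP/val_inj e; rewrite -e eqxx in h0.
Qed.

(** Writing each symbol as a number of square roots minus 1, the product expands
    into the count of [sum_sqrt_count_shift], with h = b (j - i), minus two full
    counts p, plus p. *)
Lemma sum_legendre_corr (p a b i j : nat) : prime p -> odd p -> coprime p b ->
  \sum_(k < p) legendre (a + b * (k + i)) p * legendre (a + b * (k + j)) p =
  (i == j %[mod p])%N%:R * p%:R - 1.
Proof.
move=> pp op cpb.
have b0 : (b%:R : 'F_p) != 0.
  rewrite -[0]/(0%:R) eq_Fp_nat // mod0n -/(dvdn p b).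
  by rewrite prime_coprime in cpb.
pose N (x : 'F_p) : int := (sqrt_count x)%:R.
pose h : 'F_p := b%:R * (j%:R - i%:R).
transitivity (\sum_(x : 'F_p) (N x - 1) * (N (x + h) - 1)).
  pose g (x : 'F_p) : 'F_p := a%:R + b%:R * (x + i%:R).
  have ginj : injective g.
    by move=> x y /addrI /(mulfI b0) /addIr.
  rewrite (reindex g) /=; last exact/onW_bij/injF_bij.
  rewrite -(sum_Fp_nat (fun x => (N (g x) - 1) * (N (g x + h) - 1)) pp).
  apply: eq_bigr => k _; rewrite !legendre_sqrt_count //.
  congr ((_%:R - 1) * (_%:R - 1)); congr sqrt_count; rewrite /g /h.
    by rewrite natrD natrM natrD.
  by rewrite natrD natrM natrD; ring.
have hE : (h == 0) = (i == j %[mod p])%N.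
  by rewrite /h mulf_eq0 (negbTE b0) subr_eq0 eq_sym eq_Fp_nat.
have S1 : \sum_(x : 'F_p) N x = p%:R.
  by rewrite -[in RHS](sum_sqrt_count pp) -natr_sum.
have S2 : \sum_(x : 'F_p) N (x + h) = p%:R.
  rewrite -S1 [RHS](reindex (fun x => x + h)) //.
  by apply/onW_bij/injF_bij/addIr.
have S3 : \sum_(x : 'F_p) N x * N (x + h) = p%:R - 1 + (h == 0)%:R * p%:R.
  under eq_bigr do rewrite -natrM.
  rewrite -natr_sum sum_sqrt_count_shift // natrD natrM.
  by rewrite -subn1 natrB ?prime_gt0.
rewrite (eq_bigr (fun x => N x * N (x + h) - N x - N (x + h) + 1)); last first.
  by move=> x _; ring.
rewrite big_split /= !sumrB S1 S2 S3 sumr_const card_Fp // hE; ring.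
Qed.

Lemma sum_legendre (p a b : nat) : prime p -> odd p -> coprime p b ->
  \sum_(k < p) legendre (a + b * k) p = 0.
Proof.
move=> pp op cpb.
have b0 : (b%:R : 'F_p) != 0.
  rewrite -[0]/(0%:R) eq_Fp_nat // mod0n -/(dvdn p b).
  by rewrite prime_coprime in cpb.
transitivity (\sum_(x : 'F_p) ((sqrt_count x)%:R - 1) : int).
  pose g (x : 'F_p) : 'F_p := a%:R + b%:R * x.
  have ginj : injective g by move=> x y /addrI /(mulfI b0).
  rewrite (reindex g) /=; last exact/onW_bij/injF_bij.
  rewrite -(sum_Fp_nat (fun x => (sqrt_count (g x))%:R - 1 : int) pp).
  by apply: eq_bigr => k _; rewrite legendre_sqrt_count // natrD natrM.
rewrite sumrB -natr_sum sum_sqrt_count // sumr_const card_Fp //.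
by rewrite subrr.
Qed.

(** * Products of Legendre symbols *)

Definition odd_primes (s : seq nat) := uniq s && all (fun p => prime p && odd p) s.

(** The Jacobi symbol of n modulo the product of s. *)
Definition chi (R : pzRingType) (s : seq nat) (n : nat) : R :=
  \prod_(p <- s) (legendre n p)%:~R.

Lemma odd_primes_cons (p : nat) (s : seq nat) :
  odd_primes (p :: s) = [&& prime p, odd p, p \notin s & odd_primes s].
Proof. by rewrite /odd_primes /= -!andbA; do 3!bool_congr; rewrite andbCA. Qed.

Lemma coprime_prod_primes (p : nat) (s : seq nat) :
  prime p -> p \notin s -> all prime s -> coprime p (\prod_(q <- s) q).
Proof.
move=> pp; elim: s => [|q s IH]; first by rewrite big_nil coprimen1.
rewrite inE negb_or big_cons => /andP[pq ps] /= /andP[qp sp].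
by rewrite coprimeMr IH // andbT prime_coprime // dvdn_prime2.
Qed.

Lemma odd_primes_prime (s : seq nat) : odd_primes s -> all prime s.
Proof. by case/andP=> _; apply: sub_all => p /andP[]. Qed.

Lemma dvdn_prod_mem (p : nat) (s : seq nat) : p \in s -> (p %| \prod_(q <- s) q)%N.
Proof. by move=> ps; rewrite (big_rem p) //= dvdn_mulr. Qed.

Lemma prod_primes_gt0 (s : seq nat) : all prime s -> (0 < \prod_(q <- s) q)%N.
Proof.
elim: s => [|q s IH]; rewrite ?big_nil ?big_cons //= => /andP[qp sp].
by rewrite muln_gt0 prime_gt0 ?IH.
Qed.

(** Complete sums factor over the primes by the Chinese remainder theorem. *)
Lemma sum_prod_periodic (R : comPzRingType) (s : seq nat) (g : nat -> nat -> R) :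
  odd_primes s -> (forall p k, p \in s -> g p (k %% p)%N = g p k) ->
  \sum_(k < (\prod_(p <- s) p)%N) \prod_(p <- s) g p k =
  \prod_(p <- s) \sum_(k < p) g p k.
Proof.
elim: s => [|p s IH].
  by rewrite !big_nil => _ _; rewrite big_ord1 big_nil.
rewrite odd_primes_cons => /and4P[pp op ps os] gper.
have sp := odd_primes_prime os.
rewrite [(\prod_(_ <- _) _)%N]big_cons [RHS]big_cons -IH //; last first.
  by move=> q k qs; apply: gper; rewrite inE qs orbT.
rewrite -(big_mod_prod (g := g p) (u := fun k => \prod_(q <- s) g q k)) //.
- by apply: eq_bigr => k _; rewrite big_cons.
- exact: prime_gt0.
- exact: prod_primes_gt0.
- exact: coprime_prod_primes.
- by move=> k; apply: gper; rewrite inE eqxx.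
- move=> k; apply: eq_big_seq => q qs.
  have qs' : q \in p :: s by rewrite inE qs orbT.
  rewrite -(gper q (k %% _)%N) // -[RHS]gper // modn_dvdm //.
  exact: dvdn_prod_mem.
Qed.

Lemma legendre_mod (m n p : nat) : m = n %[mod p] -> legendre m p = legendre n p.
Proof. by move=> e; rewrite /legendre /dvdn e. Qed.

Lemma norm_legendre_le1 (R : numDomainType) (n p : nat) :
  `|(legendre n p)%:~R| <= 1 :> R.
Proof.
rewrite /legendre; case: ifP => _; first by rewrite mulr0z normr0.
by case: ifP => _; rewrite ?mulrN1z ?normrN normr1.
Qed.

Lemma norm_chi_le1 (R : numDomainType) (s : seq nat) (n : nat) : `|chi R s n| <= 1.
Proof.
rewrite /chi; elim: s => [|p s IH]; first by rewrite big_nil normr1.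
by rewrite big_cons normrM mulr_ile1 // norm_legendre_le1.
Qed.

Lemma progression_mod (a b k p : nat) : a + b * (k %% p) = a + b * k %[mod p].
Proof. by apply/eqP; rewrite eqn_modDl modnMmr. Qed.

Lemma chi_full_sum (R : comPzRingType) (s : seq nat) (a b : nat) :
  s != [::] -> odd_primes s -> all (fun p => coprime p b) s ->
  \sum_(k < (\prod_(p <- s) p)%N) chi R s (a + b * k) = 0.
Proof.
move=> s0 os cb.
rewrite (sum_prod_periodic (g := fun p k => (legendre (a + b * k) p)%:~R)) //; last first.
  by move=> p k _; congr (_%:~R); apply: legendre_mod; apply: progression_mod.
case: s s0 os cb => // p s _; rewrite odd_primes_cons => /and4P[pp op _ _] /andP[cpb _].
by rewrite big_cons -rmorph_sum /= sum_legendre // mul0r.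
Qed.

Lemma chi_corr (R : comPzRingType) (s : seq nat) (a b i j : nat) :
  odd_primes s -> all (fun p => coprime p b) s ->
  \sum_(k < (\prod_(p <- s) p)%N) chi R s (a + b * (k + i)) * chi R s (a + b * (k + j)) =
  \prod_(p <- s) ((i == j %[mod p])%N%:R * p%:R - 1).
Proof.
move=> os cb.
have per p k c : (a + b * (k %% p + c) = a + b * (k + c) %[mod p])%N.
  by rewrite -modnDmr -modnMmr modnDml modnMmr modnDmr.
pose g p k : R :=
  (legendre (a + b * (k + i)) p)%:~R * (legendre (a + b * (k + j)) p)%:~R.
transitivity (\sum_(k < (\prod_(p <- s) p)%N) \prod_(p <- s) g p k).
  by apply: eq_bigr => k _; rewrite /chi -big_split.
rewrite sum_prod_periodic //; last first.
  by move=> p k _; congr (_%:~R * _%:~R); apply: legendre_mod; apply: per.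
apply: eq_big_seq => p ps.
have /andP[pp op] : prime p && odd p by case/andP: os => _ /allP; apply.
rewrite /g; under eq_bigr do rewrite -intrM.
rewrite -rmorph_sum /= sum_legendre_corr ?(allP cb) //.
by rewrite rmorphB rmorphM /= !rmorph_nat rmorph1.
Qed.

(** The summand expands into the sum of e over the divisors e of the product d
    of s that divide a + b j.  A divisor e has at most J / e + 1 hits, hence
    contributes at most J + e.  The induction on s removes one prime at a time by
    passing to the subprogression of its multiples. *)
Lemma sum_dvd_weight_le (R : realFieldType) (s : seq nat) (a b J : nat) :
  odd_primes s -> all (fun p => coprime p b) s ->
  \sum_(j < J) \prod_(p <- s) (1 + (p %| a + b * j)%N%:R * p%:R) <=
  3 ^+ size s * (J + \prod_(p <- s) p)%N%:R :> R.
Proof.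
elim: s a b J => [|p s IH] a b J.
  move=> _ _; rewrite big_nil expr0 mul1r.
  under eq_bigr do rewrite big_nil.
  by rewrite sumr_const card_ord ler_nat; lia.
rewrite odd_primes_cons /= => /and4P[pp op ps os] /andP[cpb cb].
have [r rp hr] := dvd_progression a pp cpb.
have p0 := prime_gt0 pp.
pose F j : R := \prod_(q <- s) (1 + (q %| a + b * j)%N%:R * q%:R).
under eq_bigr do rewrite big_cons hr mulrDl mul1r -mulrA mulrCA -/(F _).
rewrite big_split /=.
have -> : \sum_(i < J) p%:R * ((i %% p == r)%N%:R * F i) =
    p%:R * \sum_(k < (J + (p.-1 - r)) %/ p) F (r + p * k)%N.
  rewrite -(sum_residue_class _ _ rp) -big_distrr /=; congr (_ * _).
  rewrite [RHS]big_mkcond /=; apply: eq_bigr => k _.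
  by case: eqP; rewrite ?mul1r ?mul0r.
have sp := odd_primes_prime os.
have D0 := prod_primes_gt0 sp.
have IH1 := IH a b J os cb.
have := IH (a + b * r)%N (b * p)%N ((J + (p.-1 - r)) %/ p)%N os.
have -> : all (fun q => coprime q (b * p)) s.
  apply/allP => q qs; have qp : prime q := allP sp q qs.
  have qNp : q != p by apply: contraNneq ps => <-.
  by rewrite coprimeMr (allP cb) //= prime_coprime // dvdn_prime2.
move/(_ isT) => IH2.
rewrite big_cons; set D := (\prod_(q <- s) q)%N in D0 IH1 IH2 *.
set J' := (_ %/ p)%N in IH2 *.
have hJ' : (p * J' <= J + p)%N.
  by have := leq_divM (J + (p.-1 - r)) p; rewrite -/J'; lia.
apply: (@le_trans _ _ (3 ^+ size s * (J + D)%:R + p%:R * (3 ^+ size s * (J' + D)%:R))).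
  apply: lerD => //; rewrite ler_pM2l ?ltr0n //.
  apply: le_trans IH2; rewrite le_eqVlt; apply/orP; left; apply/eqP.
  apply: eq_bigr => k _; apply: eq_bigr => q _; rewrite mulnDr mulnA addnA.
  by [].
rewrite exprS mulrCA -mulrDr [3 * _]mulrC -mulrA ler_pM2l ?exprn_gt0 //.
rewrite -!natrM -natrD ler_nat; nia.
Qed.

(** * Incomplete character sums *)

(** Cauchy-Schwarz against the constant sequence: the variance about the mean
    is nonnegative. *)
Lemma sqr_sum_le (R : realFieldType) (K : nat) (g : nat -> R) :
  (\sum_(k < K) g k) ^+ 2 <= K%:R * \sum_(k < K) g k ^+ 2.
Proof.
case: K => [|K]; first by rewrite !big_ord0 mulr0 expr0n.
set S := \sum_(k < _) g k; set Q := \sum_(k < _) _ ^+ 2.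
have K0 : 0 < K.+1%:R :> R by rewrite ltr0n.
pose m := S / K.+1%:R.
have : 0 <= \sum_(k < K.+1) (g k - m) ^+ 2 by apply: sumr_ge0 => k _; apply: sqr_ge0.
rewrite (eq_bigr (fun k : 'I_K.+1 => g k ^+ 2 - g k * (m *+ 2) + m ^+ 2)); last first.
  by move=> k _; rewrite sqrrB mulrnAr.
rewrite big_split /= sumrB -mulr_suml -/S -/Q sumr_const card_ord => h.
rewrite -subr_ge0; apply: le_trans (mulr_ge0 (ltW K0) h) _.
rewrite -[m ^+ 2 *+ _]mulr_natl -[m *+ 2]mulr_natl le_eqVlt; apply/orP; left; apply/eqP.
by rewrite /m; field; rewrite addrC natr1 gt_eqF.
Qed.

Lemma shifted_sum_dist (R : numDomainType) (f : nat -> R) (K j : nat) :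
  (forall k, `|f k| <= 1) ->
  `|\sum_(k < K) f (k + j)%N - \sum_(k < K) f k| <= (2 * j)%:R.
Proof.
move=> f1; elim: j => [|j IH].
  by under eq_bigr do rewrite addn0; rewrite subrr normr0 muln0.
have E : \sum_(k < K) f (k + j.+1)%N - \sum_(k < K) f (k + j)%N = f (K + j)%N - f j.
  elim: K {IH} => [|K IHK]; first by rewrite !big_ord0 !subrr.
  by rewrite !big_ord_recr /= opprD addrACA IHK addnS addrC subrKA addSn.
rewrite -(subrK (\sum_(k < K) f (k + j)%N) (\sum_(k < K) _ (_ + j.+1)%N)) E -addrA.
rewrite mulnS natrD; apply: le_trans (ler_normD _ _) _; apply: lerD => //.
by apply: le_trans (ler_normB _ _) _; rewrite mulr2n lerD.
Qed.

Lemma sum_periodic_reduce (V : nmodType) (f : nat -> V) (d K : nat) :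
  (forall k, f (k + d)%N = f k) -> \sum_(k < d) f k = 0 ->
  \sum_(k < K) f k = \sum_(k < K %% d) f k.
Proof.
move=> fd f0; move: (K %/ d)%N (K %% d)%N (divn_eq K d) => q r -> {K}.
elim: q => [//|q IH].
rewrite mulSn -addnA big_split_ord /= f0 add0r -[RHS]IH.
by apply: eq_bigr => k _; rewrite addnC fd.
Qed.

(** Modulo a divisor p of d, the number (d - 1) j stands for - j; this writes
    i = j mod p as divisibility along a progression in i. *)
Lemma eq_mod_dvd_complement (p d i j : nat) : (0 < d)%N -> (p %| d)%N ->
  (i == j %[mod p])%N = (p %| d.-1 * j + 1 * i)%N.
Proof.
move=> d0 pd; rewrite mul1n -(eqn_modDl (d.-1 * j)).
have -> : (d.-1 * j + j = d * j)%N by rewrite -mulSnr prednK.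
by rewrite (eqP (dvdn_mulr j pd : (d * j %% p)%N == 0)).
Qed.

(** Only K modulo the period d matters, because complete sums vanish; if d <= J
    the trivial bound suffices.  Otherwise J T, for T the sum, is within 2 J^2 of
    the sum X over k of the J-term window sums G k.  Cauchy-Schwarz over a full
    period gives X^2 <= d * (sum of G k ^ 2), and opening the square produces the
    correlations [chi_corr], at most 2 * 3^(size s) * d * J in total by
    [sum_dvd_weight_le].  The hypothesis on J is what turns this into
    |X| <= J d / A. *)
Lemma incomplete_sum_le (R : realFieldType) (s : seq nat) (a b K J : nat) (A : R) :
  s != [::] -> odd_primes s -> all (fun p => coprime p b) s ->
  0 < A -> 2 * 3 ^+ size s * A ^+ 2 <= J%:R ->
  `|\sum_(k < K) chi R s (a + b * k)| <= 2 * J%:R + (\prod_(p <- s) p)%N%:R / A.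
Proof.
move=> s0 os cb A0 hJ.
set d := (\prod_(p <- s) p)%N.
have d0 : (0 < d)%N := prod_primes_gt0 (odd_primes_prime os).
pose f k : R := chi R s (a + b * k).
have f1 k : `|f k| <= 1 by exact: norm_chi_le1.
have fd k : f (k + d)%N = f k.
  apply: eq_big_seq => p ps; congr (_%:~R); apply: legendre_mod.
  rewrite -(progression_mod a b k) -(progression_mod a b (k + d)).
  suff -> : ((k + d) %% p = k %% p)%N by [].
  by rewrite -modnDmr (eqP (dvdn_prod_mem ps)) addn0.
rewrite (sum_periodic_reduce (f := f) K fd); last exact: chi_full_sum.
have rd : (K %% d < d)%N by rewrite ltn_mod.
move: (K %% d)%N rd => r rd.
have T1 : `|\sum_(k < r) f k| <= r%:R.
  apply: le_trans (ler_norm_sum _ _ _) _.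
  by rewrite -[r in leRHS]card_ord -sumr_const; apply: ler_sum => k _; exact: f1.
have dA : 0 <= d%:R / A by rewrite divr_ge0 ?ler0n ?ltW.
have [dJ|Jd] := leqP d J.
  have : r%:R <= J%:R :> R by rewrite ler_nat; lia.
  have := ler0n R J; lra.
have J0 : 0 < J%:R :> R.
  by apply: lt_le_trans hJ; rewrite !mulr_gt0 ?exprn_gt0 ?ltr0n.
pose G k : R := \sum_(j < J) f (k + j)%N.
set T := \sum_(k < r) f k in T1 *.
pose X := \sum_(k < r) G k.
have h1 : `|X - J%:R * T| <= J%:R * (2 * J%:R).
  rewrite /X /G exchange_big /= mulr_natl -[J in T *+ J]card_ord -sumr_const -sumrB.
  apply: le_trans (ler_norm_sum _ _ _) _.
  rewrite mulr_natl -[J in _ *+ J]card_ord -sumr_const; apply: ler_sum => j _.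
  apply: le_trans (shifted_sum_dist r j f1) _.
  by rewrite -natrM ler_nat leq_mul2l ltnW.
have h2 : X ^+ 2 <= d%:R * \sum_(k < d) G k ^+ 2.
  apply: le_trans (sqr_sum_le _ _) _.
  apply: ler_pM; rewrite ?ler0n ?ler_nat ?(ltnW rd) //.
    by apply: sumr_ge0 => k _; apply: sqr_ge0.
  rewrite -!(big_mkord xpredT (fun k => G k ^+ 2)) (big_cat_nat (leq0n r) (ltnW rd)) //= lerDl.
  by apply: sumr_ge0 => k _; apply: sqr_ge0.
have h3 : \sum_(k < d) G k ^+ 2 <= J%:R * (3 ^+ size s * (J + d)%:R).
  have -> : \sum_(k < d) G k ^+ 2 =
      \sum_(j < J) \sum_(i < J) \sum_(k < d) f (k + i)%N * f (k + j)%N.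
    under [RHS]eq_bigr do rewrite exchange_big /=.
    rewrite [RHS]exchange_big /=; apply: eq_bigr => k _.
    rewrite expr2 /G big_distrlr /= exchange_big /=.
    by apply: eq_bigr => j _; apply: eq_bigr => i _.
  rewrite mulr_natl -[J in _ *+ J]card_ord -sumr_const; apply: ler_sum => j _.
  have c1 : all (fun p => coprime p 1) s by apply/allP => p _; rewrite coprimen1.
  apply: le_trans (sum_dvd_weight_le R (d.-1 * j) J os c1).
  apply: ler_sum => i _; rewrite chi_corr //.
  apply: le_trans (ler_norm _) _; rewrite normr_prod; rewrite !big_seq; apply: ler_prod => p ps.
  rewrite normr_ge0 /= -eq_mod_dvd_complement //; last exact: dvdn_prod_mem.
  by apply: le_trans (ler_normB _ _) _; rewrite normr1 addrC lerD // ger0_norm // mulr_ge0 ?ler0n.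
have h4 : X ^+ 2 <= (J%:R * (d%:R / A)) ^+ 2.
  apply: le_trans h2 _.
  apply: le_trans (ler_wpM2l (ler0n _ _) h3) _.
  apply: (@le_trans _ _ (d%:R * (J%:R * (3 ^+ size s * (2 * d%:R))))).
    do 3! [apply: ler_wpM2l; first by rewrite ?ler0n ?exprn_ge0].
    by rewrite -natrM ler_nat mul2n -addnn leq_add2r ltnW.
  rewrite exprMn expr_div_n [leRHS]mulrA ler_pdivlMr ?exprn_gt0 //.
  have -> : d%:R * (J%:R * (3 ^+ size s * (2 * d%:R))) * A ^+ 2 = J%:R * d%:R ^+ 2 * (2 * 3 ^+ size s * A ^+ 2) by ring.
  have -> : J%:R ^+ 2 * d%:R ^+ 2 = J%:R * d%:R ^+ 2 * J%:R :> R by ring.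
  by rewrite ler_wpM2l // mulr_ge0 ?exprn_ge0 ?ler0n.
have h5 : `|X| <= J%:R * (d%:R / A).
  rewrite -ler_sqr ?nnegrE ?normr_ge0 //; last by rewrite mulr_ge0 ?ler0n.
  by rewrite real_normK ?num_real.
have -> : `|T| = `|J%:R * T| / J%:R.
  by rewrite normrM ger0_norm ?ler0n // mulrAC divff ?mul1r // gt_eqF.
rewrite ler_pdivrMr //.
have -> : J%:R * T = X - (X - J%:R * T) by rewrite subKr.
apply: le_trans (ler_normB _ _) _.
by rewrite [leRHS]mulrC mulrDr addrC lerD.
Qed.

(** * Sieving with quadratic characters *)

(** Twice the indicator of the nonzero squares for each prime, written so that the
    product can be expanded into characters and divisibility conditions. *)
Definition qr_weight (R : pzRingType) (s : seq nat) (n : nat) : R :=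
  \prod_(p <- s) (1 - (p %| n)%N%:R + (legendre n p)%:~R).

Definition euler_factor (R : unitRingType) (s : seq nat) : R :=
  \prod_(p <- s) (1 - p%:R^-1).

Lemma inv_prime_le (R : realFieldType) (p : nat) : prime p -> p%:R^-1 <= 2^-1 :> R.
Proof.
by move=> pp; rewrite lef_pV2 ?posrE ?ltr0n ?prime_gt0 // ler_nat prime_gt1.
Qed.

Lemma euler_factor_bounds (R : realFieldType) (s : seq nat) : all prime s ->
  2^-1 ^+ size s <= euler_factor R s <= 1.
Proof.
rewrite /euler_factor; elim: s => [|p s IH] /=; first by rewrite big_nil lexx.
move=> /andP[pp /IH /andP[h1 h2]]; rewrite big_cons exprS.
have e1 := inv_prime_le R pp.
have e0 : 0 <= p%:R^-1 :> R by rewrite invr_ge0 ler0n.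
have h0 : 0 <= 2^-1 ^+ size s :> R by rewrite exprn_ge0 // invr_ge0.
apply/andP; split.
  by apply: ler_pM => //; rewrite ?invr_ge0 //; lra.
by apply: mulr_ile1; [lra|exact: le_trans h1|lra|exact: h2].
Qed.

(** Induction on s: the three terms of the factor at p give the same sum for s, a
    sum along the subprogression of multiples of p, and a sum with p moved into the
    character.  The parameter t lists the primes already moved; a main term
    survives only if there are none.  Each step multiplies the error by at most 3
    and adds the rounding error 1 <= B of K / p, whence 4 ^ size s. *)
Lemma qr_weight_sum (R : realFieldType) (Q : seq nat) (B : R) : 1 <= B ->
  (forall u a b K, u != [::] -> odd_primes u -> {subset u <= Q} ->
     all (fun p => coprime p b) u -> `|\sum_(k < K) chi R u (a + b * k)| <= B) ->
  forall s t a b K, odd_primes (s ++ t) -> {subset s ++ t <= Q} ->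
    all (fun p => coprime p b) (s ++ t) ->
    `|\sum_(k < K) chi R t (a + b * k) * qr_weight R s (a + b * k)
      - (t == [::])%:R * K%:R * euler_factor R s| <= 4 ^+ size s * B.
Proof.
move=> B1 HB; elim=> [|p s IH] t a b K.
  move=> /= ot tQ ct; rewrite expr0 mul1r /euler_factor big_nil mulr1.
  under eq_bigr do rewrite /qr_weight big_nil mulr1.
  case: eqP => [->|/eqP t0].
    under eq_bigr do rewrite /chi big_nil.
    by rewrite sumr_const card_ord mul1r subrr normr0; lra.
  by rewrite mul0r subr0 HB.
rewrite [(_ :: s) ++ t]/= => ost stQ cst.
have per : perm_eq (s ++ p :: t) (p :: s ++ t) by apply/permPl/(perm_catCA s [:: p] t).
have := ost; rewrite odd_primes_cons => /and4P[pp op pst ost'].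
have stQ' : {subset s ++ t <= Q} by move=> q qs; apply: stQ; rewrite inE qs orbT.
have /= /andP[cpb cst'] := cst.
have [r rp hr] := dvd_progression a pp cpb.
have p0 := prime_gt0 pp.
set Kp := ((K + (p.-1 - r)) %/ p)%N.
pose F n : R := chi R t n * qr_weight R s n.
have V01 := euler_factor_bounds R (_ : all prime s).
have /V01/andP[V0 V1] : all prime s.
  by have := odd_primes_prime ost'; rewrite all_cat => /andP[].
clear V01; set V := euler_factor R s in V0 V1 *.
have {}V0 : 0 <= V by apply: le_trans V0; rewrite exprn_ge0 // invr_ge0.
have -> : euler_factor R (p :: s) = (1 - p%:R^-1) * V by rewrite /euler_factor big_cons.
have -> : \sum_(k < K) chi R t (a + b * k) * qr_weight R (p :: s) (a + b * k) =
    \sum_(k < K) F (a + b * k)%N - \sum_(k < Kp) F (a + b * r + b * p * k)%N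
    + \sum_(k < K) chi R (p :: t) (a + b * k) * qr_weight R s (a + b * k).
  have -> : \sum_(k < Kp) F (a + b * r + b * p * k)%N =
            \sum_(k < K) (p %| a + b * k)%N%:R * F (a + b * k)%N.
    under [RHS]eq_bigr do rewrite hr.
    transitivity (\sum_(k < Kp) F (a + b * (r + p * k))%N).
      by apply: eq_bigr => k _; rewrite mulnDr mulnA addnA.
    rewrite -(sum_residue_class _ (fun k => F (a + b * k)%N) rp) big_mkcond /=.
    by apply: eq_bigr => k _; case: eqP; rewrite ?mul1r ?mul0r.
  rewrite -sumrB -big_split /=; apply: eq_bigr => k _.
  by rewrite /F /qr_weight /chi !big_cons; ring.
have I1 := IH t a b K ost' stQ' cst'.
have I2 : `|\sum_(k < Kp) F (a + b * r + b * p * k)%N - (t == [::])%:R * Kp%:R * V| <= 4 ^+ size s * B.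
  apply: IH => //; apply/allP => q qs.
  have qp : prime q := allP (odd_primes_prime ost') q qs.
  have qNp : q != p by apply: contraNneq pst => <-.
  by rewrite coprimeMr (allP cst') //= prime_coprime // dvdn_prime2.
have I3 : `|\sum_(k < K) chi R (p :: t) (a + b * k) * qr_weight R s (a + b * k)| <= 4 ^+ size s * B.
  have := IH (p :: t) a b K; rewrite /= !mul0r subr0; apply.
  - by move: ost; rewrite /odd_primes (perm_uniq per) (perm_all _ per).
  - by move=> q; rewrite (perm_mem per); apply: stQ.
  - by rewrite (perm_all _ per).
have I4 : `|(t == [::])%:R * (Kp%:R - K%:R / p%:R) * V| <= 1.
  rewrite !normrM (ger0_norm V0) mulr_ile1 ?mulr_ge0 // mulr_ile1 ?normr_ge0 //.
    by case: eqP => _; rewrite ?normr1 ?normr0.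
  exact: count_residue_class.
have E1 : 1 <= 4 ^+ size s * B.
  by rewrite mulr_ege1 // exprn_ege1 // ler1n.
have -> : 4 ^+ size (p :: s) * B = 4 * (4 ^+ size s * B) by rewrite mulrA -exprS.
move: (4 ^+ size s * B) I1 I2 I3 E1 => E I1 I2 I3 E1.
set b0 : R := (t == [::])%:R in I1 I2 I4 *.
move: I1 I2 I3 I4; rewrite /F.
set S1 := \sum_(k < K) _; set S2 := \sum_(k < Kp) _; set S3 := \sum_(k < K) _.
move=> I1 I2 I3 I4.
have -> : S1 - S2 + S3 - b0 * K%:R * ((1 - p%:R^-1) * V) =
  (S1 - b0 * K%:R * V) - (S2 - b0 * Kp%:R * V) + S3 - b0 * (Kp%:R - K%:R / p%:R) * V.
  by ring.
apply: le_trans (ler_normB _ _) _; apply: le_trans (lerD (ler_normD _ _) I4) _.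
have := ler_normB (S1 - b0 * K%:R * V) (S2 - b0 * Kp%:R * V).
lra.
Qed.

(** * Primes, primorials and squares *)

(** Convertible to [primes_le x] when N is the truncation of x. *)
Definition primes_upto (N : nat) : seq nat := [seq p <- iota 0 N.+1 | prime p].

Lemma primes_upto_prime (N : nat) : all prime (primes_upto N).
Proof. exact: filter_all. Qed.

Lemma primes_uptoS (N : nat) :
  primes_upto N.+1 = primes_upto N ++ (if prime N.+1 then [:: N.+1] else [::]).
Proof. by rewrite /primes_upto -[in LHS]addn1 iotaD filter_cat /= add0n. Qed.

(** Primes above C are absorbed by the primorial, and there are at most C others. *)
Lemma exp_size_le_primorial (C N : nat) : (0 < C)%N ->
  (C ^ size (primes_upto N) <= C ^ minn N C * \prod_(p <- primes_upto N) p)%N.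
Proof.
move=> C0; elim: N => [|N IH]; first by rewrite /primes_upto /= big_nil min0n.
have mono : (C ^ minn N C <= C ^ minn N.+1 C)%N by rewrite leq_pexp2l //; lia.
rewrite primes_uptoS; case: ifP => _; last first.
  by rewrite cats0; apply: leq_trans IH _; rewrite leq_mul2r mono orbT.
rewrite size_cat big_cat /= big_seq1 addn1 expnS.
set m := (\prod_(p <- _) p)%N in IH *.
have [NC|CN] := boolP (N.+1 <= C)%N.
  have -> : minn N.+1 C = (minn N C).+1 by lia.
  by rewrite expnS; nia.
have -> : minn N.+1 C = minn N C by lia.
by nia.
Qed.

Lemma exp_size_O_primorial (C : nat) : (0 < C)%N ->
  exists2 c, (0 < c)%N &
    forall N, (C ^ size (primes_upto N) <= c * \prod_(p <- primes_upto N) p)%N.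
Proof.
move=> C0; exists (C ^ C)%N => [|N]; first by rewrite expn_gt0 C0.
apply: leq_trans (exp_size_le_primorial N C0) _.
by rewrite leq_mul2r leq_pexp2l ?orbT //; lia.
Qed.

Lemma leq_size_primes_upto (m n : nat) : (m <= n)%N ->
  (size (primes_upto m) <= size (primes_upto n))%N.
Proof.
move=> /subnK <-; elim: (n - m)%N => // k IH; apply: leq_trans IH _.
by rewrite addSn primes_uptoS size_cat leq_addr.
Qed.

Lemma size_primes_upto_unbounded (k : nat) :
  exists N0, forall N, (N0 <= N)%N -> (k <= size (primes_upto N))%N.
Proof.
elim: k => [|k [N0 IH]]; first by exists 0%N.
have [p pN pp] := prime_above N0.
exists p => N pN'; apply: leq_trans (leq_size_primes_upto pN').
case: p pN pp {pN'} => // p pN pp.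
by rewrite primes_uptoS pp size_cat addn1 ltnS IH.
Qed.

Definition odd_primes_upto (N : nat) : seq nat := [seq p <- iota 3 (N - 2) | prime p].

Lemma primes_uptoE (N : nat) : (2 <= N)%N -> primes_upto N = 2%N :: odd_primes_upto N.
Proof.
move=> N2; rewrite /primes_upto /odd_primes_upto.
by have -> : N.+1 = (3 + (N - 2))%N by lia; rewrite iotaD filter_cat.
Qed.

Lemma mem_odd_primes_upto (N p : nat) :
  (p \in odd_primes_upto N) = [&& prime p, odd p & (p <= N)%N].
Proof.
rewrite mem_filter mem_iota; case pp: (prime p) => //=.
have [-> //|op] := even_prime pp; rewrite op /=.
have p1 := prime_gt1 pp; have p2 : p != 2%N by apply: contraTneq op => ->.
by lia.
Qed.

Lemma odd_primes_odd_primes_upto (N : nat) : odd_primes (odd_primes_upto N).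
Proof.
rewrite /odd_primes filter_uniq ?iota_uniq //=.
by apply/allP => p; rewrite mem_odd_primes_upto => /and3P[-> ->].
Qed.

Definition is_square (n : nat) := [exists k : 'I_n.+1, n == (k ^ 2)%N].

Lemma is_squareP (n : nat) : reflect (exists m, n = (m ^ 2)%N) (is_square n).
Proof.
apply: (iffP existsP) => [[k /eqP e]|[m e]]; first by exists k.
have mn : (m < n.+1)%N by rewrite e expnS expn1; nia.
by exists (Ordinal mn); rewrite -e eqxx.
Qed.

Definition all_qr (s : seq nat) (n : nat) := all (fun p => legendre n p == 1) s.

(** A factor is 0 at a multiple of p or at a nonresidue, and 2 at a nonzero
    square. *)
Lemma qr_weightE (R : comPzRingType) (s : seq nat) (n : nat) :
  qr_weight R s n = 2 ^+ size s * (all_qr s n)%:R.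
Proof.
rewrite /qr_weight /all_qr; elim: s => [|p s IH]; first by rewrite big_nil mul1r.
rewrite big_cons IH /= exprS /legendre.
case: ifP => _; first by rewrite subrr add0r !mul0r mulr0.
case: ifP => _ /=; last by rewrite subr0 mulrN1z subrr !mul0r mulr0.
by rewrite subr0 mulr1z -mulr2n mulrA.
Qed.

Lemma nat_sqrt_exists (M : nat) : exists r, (r ^ 2 <= M < r.+1 ^ 2)%N.
Proof.
elim: M => [|M [r /andP[h1 h2]]]; first by exists 0%N.
have [h|h] := leqP (r.+1 ^ 2) M.+1.
  by exists r.+1; rewrite h /=; apply: leq_ltn_trans h2 _; rewrite ltn_sqr.
by exists r; rewrite h andbT; lia.
Qed.

Lemma sum_is_square_le (L M r : nat) : (forall m, (m < L)%N -> (1 + 8 * m <= M)%N) ->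
  (M < r.+1 ^ 2)%N -> (\sum_(m < L) is_square (1 + 8 * m) <= r.+1)%N.
Proof.
move=> LM Mr.
apply: (@leq_trans (\sum_(m < L) \sum_(k < r.+1) (1 + 8 * m == k ^ 2))%N).
  apply: leq_sum => m _; case: is_squareP => // -[k hk].
  have kr : (k < r.+1)%N.
    by rewrite -ltn_sqr; apply: leq_ltn_trans Mr; rewrite -hk LM.
  by rewrite (bigD1 (Ordinal kr)) //= hk eqxx.
rewrite exchange_big /= -[leqRHS]muln1 -[r.+1 in leqRHS]card_ord -sum_nat_const.
apply: leq_sum => k _; have [/existsP[m /eqP hm]|/existsPn h] := boolP [exists m : 'I_L, 1 + 8 * m == k ^ 2]%N.
  rewrite (bigD1 m) //= hm eqxx big1 // => i im.
  case: eqP => // hi; case/eqP: im; apply: val_inj => /=; lia.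
by rewrite big1 // => m _; rewrite (negbTE (h m)).
Qed.

(** * The number of pseudosquares up to the primorial *)

(** The index m stands for n = 1 + 8 m; the range is exactly n <= primorial
    ([ltn_ceil_div8]). *)
Definition pseudosquare_count (N : nat) : nat :=
  \sum_(m < (\prod_(p <- primes_upto N) p + 7) %/ 8)
    (all_qr (odd_primes_upto N) (1 + 8 * m) && ~~ is_square (1 + 8 * m)).

Lemma ceil_div8_bounds (M : nat) : (M <= (M + 7) %/ 8 * 8 <= M + 7)%N.
Proof.
have := leq_divM (M + 7) 8; have := ltn_ceil (M + 7) (isT : (0 < 8)%N).
by move: ((M + 7) %/ 8)%N => L; lia.
Qed.

Lemma ltn_ceil_div8 (M m : nat) : (m < (M + 7) %/ 8)%N = (1 + 8 * m <= M)%N.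
Proof. by rewrite leq_divRL //; apply/idP/idP; lia. Qed.

Lemma leq_prod_sub (u s : seq nat) : uniq u -> uniq s -> {subset u <= s} ->
  all prime s -> (\prod_(p <- u) p <= \prod_(p <- s) p)%N.
Proof.
move=> uu us usub sp.
rewrite [leqRHS](bigID (mem u)) /= -[X in (_ <= X * _)%N]big_filter.
have pe : perm_eq [seq p <- s | p \in u] u.
  apply: uniq_perm; rewrite ?filter_uniq // => p; rewrite mem_filter.
  by case pu: (p \in u); rewrite //= usub.
rewrite (perm_big _ pe) /= leq_pmulr // -big_filter prod_primes_gt0 //.
by apply/allP => p; rewrite mem_filter => /andP[_]; apply: allP.
Qed.

Lemma sum_all_qr (R : realFieldType) (s : seq nat) (L J : nat) (A : R) :
  odd_primes s -> 0 < A -> (0 < J)%N -> 2 * 3 ^+ size s * A ^+ 2 <= J%:R ->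
  `|2 ^+ size s * (\sum_(m < L) all_qr s (1 + 8 * m))%N%:R - L%:R * euler_factor R s| <=
  4 ^+ size s * (2 * J%:R + (\prod_(p <- s) p)%N%:R / A).
Proof.
move=> os A0 J0 hJ.
set B := _ + _ / A.
have J1 : 1 <= J%:R :> R by rewrite ler1n.
have B1 : 1 <= B.
  have : 0 <= (\prod_(p <- s) p)%N%:R / A by rewrite divr_ge0 ?ler0n ?ltW.
  by rewrite /B; lra.
have us : uniq s by case/andP: os.
have sp := odd_primes_prime os.
have c8 u : all (fun p => prime p && odd p) u -> all (fun p => coprime p 8) u.
  by apply: sub_all => p /andP[_ op]; rewrite (coprime_pexpr (k := 3) p 2) // coprimen2.
have HB u a b K : u != [::] -> odd_primes u -> {subset u <= s} ->
     all (fun p => coprime p b) u -> `|\sum_(k < K) chi R u (a + b * k)| <= B.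
  move=> u0 ou usub cb; have uu : uniq u by case/andP: ou.
  have hs : (size u <= size s)%N by exact: uniq_leq_size.
  apply: le_trans (incomplete_sum_le a K u0 ou cb A0 (_ : _ <= J%:R)) _.
    apply: le_trans hJ; apply: ler_wpM2r; first exact/exprn_ge0/ltW.
    by rewrite ler_wpM2l // ler_eXn2l ?ltr1n.
  by rewrite lerD2l; apply: ler_wpM2r; rewrite ?invr_ge0 ?(ltW A0) // ler_nat leq_prod_sub.
have := qr_weight_sum B1 HB (s := s) (t := [::]) 1 (b := 8) L.
rewrite cats0 eqxx mul1r => /(_ os (fun p ps => ps) (c8 s _)).
have -> : \sum_(k < L) chi R [::] (1 + 8 * k) * qr_weight R s (1 + 8 * k) =
    2 ^+ size s * (\sum_(m < L) all_qr s (1 + 8 * m))%N%:R.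
  rewrite natr_sum mulr_sumr; apply: eq_bigr => k _.
  by rewrite /chi big_nil mul1r qr_weightE.
by apply; case/andP: os.
Qed.

(** With q odd primes of product D and a = 2^q, the sieve is applied with
    A = a^4 and J = 2 * 768^q, the least J that [incomplete_sum_le] allows for
    this A.  Relative to the main term, the part D / A of the bound is O(1 / a), and
    the rest, squares included, is O(1 / a + a^3 * 768^q / D), which is again
    O(1 / a) because a^4 * 768^q = (16 * 768)^q is O(D). *)
Lemma pseudosquare_count_estimate (R : realFieldType) :
  exists2 c : R, 0 <= c & forall N, (2 <= N)%N ->
  `|(pseudosquare_count N)%:R * 2 ^+ (size (primes_upto N)).+1 /
    ((\prod_(p <- primes_upto N) p)%N%:R * euler_factor R (primes_upto N)) - 1|
  <= c / 2 ^+ size (primes_upto N).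
Proof.
have [c c0 hc] := @exp_size_O_primorial (16 * 768) isT.
exists (16 + 56 * c%:R) => [|N N2]; first by rewrite addr_ge0 ?mulr_ge0 ?ler0n.
have {hc} := hc N; rewrite /pseudosquare_count primes_uptoE //.
set Q := odd_primes_upto N.
have oQ : odd_primes Q := odd_primes_odd_primes_upto N.
have Qp := odd_primes_prime oQ.
rewrite /euler_factor !big_cons -/(euler_factor R Q) /=.
set D := (\prod_(p <- Q) p)%N; set q := size Q; set V := euler_factor R Q.
have /andP[V0 V1] := euler_factor_bounds R Qp; rewrite -/V -/q in V0 V1.
set L := ((2 * D + 7) %/ 8)%N.
have [r /andP[r1 r2]] := nat_sqrt_exists (2 * D).
have D0 : (0 < D)%N := prod_primes_gt0 Qp.
(* 768 = 3 * 16^2, so that J = 2 * 3^q * A^2 for A = 16^q. *)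
pose J : nat := (2 * 768 ^ q)%N.
pose a : R := 2 ^+ q; pose w : R := 768%:R ^+ q.
have a1 : 1 <= a by rewrite exprn_ege1 // ler1n.
have w1 : 1 <= w by rewrite exprn_ege1 // ler1n.
have JE : J%:R = 2 * w :> R by rewrite /J natrM natrX.
have aX k : (2 ^+ k) ^+ q = a ^+ k :> R by rewrite /a -!exprM mulnC.
have hJ : 2 * 3 ^+ q * (a ^+ 4) ^+ 2 <= J%:R.
  rewrite JE -mulrA -exprM -(aX 8%N) -exprMn ler_pM2l ?ltr0n //.
  by apply: lerXn2r; rewrite ?nnegrE ?mulr_ge0 ?exprn_ge0 ?ler0n //; lra.
have J0 : (0 < J)%N by rewrite /J muln_gt0 expn_gt0.
have := sum_all_qr L oQ (exprn_gt0 4 (lt_le_trans ltr01 a1)) J0 hJ.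
rewrite -/V -/q -/a -/D.
set T := (\sum_(m < L) all_qr Q (1 + 8 * m))%N.
have -> : 4 ^+ q = a ^+ 2 :> R by rewrite -aX; congr (_ ^+ _); rewrite -natrX.
rewrite JE => hT.
set S := (\sum_(m < L) _)%N.
have hTS : (S%:R <= T%:R :> R) && (T%:R <= S%:R + (r%:R + 1) :> R).
  pose U := (\sum_(m < L) (all_qr Q (1 + 8 * m) && is_square (1 + 8 * m)))%N.
  have -> : T = (S + U)%N.
    rewrite -big_split /=; apply: eq_bigr => m _.
    by case: all_qr; case: is_square.
  have hU : (U <= r.+1)%N.
    apply: leq_trans (@sum_is_square_le L (2 * D) r _ r2) => [|m mL].
      by apply: leq_sum => m _; case: all_qr.
    by rewrite -ltn_ceil_div8.
  by rewrite natrD lerDl ler0n lerD2l natr1 ler_nat.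
have hL : `|L%:R - D%:R / 4| <= 1 :> R.
  have := ceil_div8_bounds (2 * D); rewrite -/L -!(ler_nat R) natrD !natrM.
  by move: (L%:R) (D%:R) => l z /andP[h1 h2]; rewrite ler_norml; apply/andP; split; lra.
have hr : r%:R ^+ 2 <= 2 * D%:R :> R by rewrite -natrX -natrM ler_nat.
move=> hc.
have {}hc : a ^+ 4 * w <= c%:R * D%:R.
  have hc' : ((16 * 768) ^ q <= c * D)%N.
    rewrite -(leq_pmul2l (isT : 0 < 2)%N) mulnCA; apply: leq_trans hc.
    by rewrite -/q expnS leq_mul2r orbT.
  have : ((16 * 768) ^ q)%N%:R <= (c * D)%N%:R :> R by rewrite ler_nat.
  by rewrite natrX !natrM exprMn -(aX 4%N) -natrX.
have D0R : 0 < D%:R :> R by rewrite ltr0n.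
have a0 : 0 < a by lra.
have aV : 1 <= a * V.
  apply: le_trans (ler_wpM2l (ltW a0) V0).
  by rewrite -exprMn divff ?expr1n // pnatr_eq0.
have V0' : 0 < V by rewrite -(pmulr_rgt0 _ a0); lra.
have aw : a ^+ 2 <= w.
  rewrite -(aX 2%N) -natrX /w; apply: lerXn2r; rewrite ?nnegrE ?ler0n //.
  by rewrite ler_nat.
have -> : S%:R * 2 ^+ q.+2 / ((2 * D)%N%:R * ((1 - 2^-1) * V)) - 1 =
    (a * S%:R - D%:R * V / 4) * 4 / (D%:R * V).
  rewrite natrM !exprS -/a; field; rewrite ?gt_eqF //.
have -> : (16 + 56 * c%:R) / 2 ^+ q.+1 = (8 + 28 * c%:R) / a.
  by rewrite exprS -/a; field; rewrite gt_eqF.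
set E := a ^+ 2 * (2 * (2 * w) + D%:R / a ^+ 4) in hT.
have hX : `|a * S%:R - D%:R * V / 4| <= E + 1 + a * (r%:R + 1).
  have -> : a * S%:R - D%:R * V / 4 = (a * T%:R - L%:R * V)
     + (L%:R - D%:R / 4) * V - a * (T%:R - S%:R) by ring.
  apply: le_trans (ler_normB _ _) _; apply: lerD.
    apply: le_trans (ler_normD _ _) _; apply: lerD => //.
    by rewrite normrM (gtr0_norm V0') mulr_ile1 ?normr_ge0 // ltW.
  have /andP[h1 h2] := hTS.
  by rewrite normrM gtr0_norm // ler_pM2l // ger0_norm ?subr_ge0 // lerBlDl.
rewrite normrM normfV normrM (gtr0_norm (mulr_gt0 D0R V0')) (@ger0_norm _ 4) //.
rewrite ler_pdivrMr ?mulr_gt0 //.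
apply: (@le_trans _ _ ((8 + 28 * c%:R) / a * D%:R / a)); last first.
  have c8 : 0 < 8 + 28 * c%:R :> R by have := ler0n R c; lra.
  rewrite -mulrA ler_pM2l ?divr_gt0 //.
  by rewrite ler_pM2l // -(ler_pM2l a0) divff ?gt_eqF.
apply: le_trans (ler_wpM2r (ler0n _ _) hX) _.
rewrite ler_pdivlMr // [leRHS]mulrAC ler_pdivlMr //.
have EE : E * a ^+ 2 = 4 * (a ^+ 4 * w) + D%:R.
  by rewrite /E; field; rewrite gt_eqF.
(* The squares: r is at most sqrt (2 D), split by the arithmetic-geometric mean. *)
have a3 : 4 * a ^+ 3 * r%:R <= 2 * D%:R + 4 * a ^+ 6.
  have := sqr_ge0 (r%:R - 2 * a ^+ 3).
  have -> : (r%:R - 2 * a ^+ 3) ^+ 2 = r%:R ^+ 2 - 4 * a ^+ 3 * r%:R + 4 * a ^+ 6 by ring.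
  by lra.
have a6 : a ^+ 6 <= a ^+ 4 * w.
  by rewrite (exprD a 4 2) ler_wpM2l // exprn_ge0 // ltW.
have a26 : a ^+ 2 <= a ^+ 6 by rewrite ler_weXn2l.
have a36 : a ^+ 3 <= a ^+ 6 by rewrite ler_weXn2l.
have -> : (E + 1 + a * (r%:R + 1)) * 4 * a * a =
  4 * (E * a ^+ 2) + 4 * a ^+ 2 + 4 * a ^+ 3 * r%:R + 4 * a ^+ 3 by ring.
rewrite EE; lra.
Qed.

(** * Chebyshev and Mertens estimates at powers of two *)

Lemma prod_primes_dvdn (s : seq nat) (n : nat) : uniq s -> all prime s ->
  all (fun p => p %| n)%N s -> (\prod_(p <- s) p %| n)%N.
Proof.
elim: s => [|p s IH] /=; first by rewrite big_nil dvd1n.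
move=> /andP[ps us] /andP[pp sp] /andP[pn sn].
by rewrite big_cons Gauss_dvd ?coprime_prod_primes // pn IH.
Qed.

Lemma prime_dvd_fact_leq (p m : nat) : prime p -> (p %| m`!)%N -> (p <= m)%N.
Proof.
move=> pp; elim: m => [|m IH]; first by rewrite fact0 dvdn1 => /eqP p1; rewrite p1 in pp.
by rewrite factS Euclid_dvdM // => /orP[/dvdn_leq->//|/IH/leqW].
Qed.

(** Such a p divides (2 m)! but not m!. *)
Lemma prime_dvd_central_bin (m p : nat) : prime p -> (m < p <= m + m)%N ->
  (p %| 'C(m + m, m))%N.
Proof.
move=> pp /andP[mp pm].
have pN : ~~ (p %| m`!)%N.
  by apply/negP => /(prime_dvd_fact_leq pp); lia.
have := bin_fact (leq_addr m m); rewrite addnK => e.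
have : (p %| (m + m)`!)%N by rewrite dvdn_fact // prime_gt0.
by rewrite -e !Euclid_dvdM // (negbTE pN) !orbF.
Qed.

Lemma bin_le_exp2 (n m : nat) : ('C(n, m) <= 2 ^ n)%N.
Proof.
have [nm|mn] := ltnP n m; first by rewrite bin_small.
rewrite -[2%N]/(1 + 1)%N expnDn (bigD1 (inord m)) //= inordK ?ltnS //.
by rewrite !exp1n !muln1 leq_addr.
Qed.

Section RealSums.
Context {R : realType}.
Implicit Types (g h : nat -> R) (n m p k K L : nat).

Lemma ln_prod (s : seq nat) (f : nat -> R) : (forall p, p \in s -> 0 < f p) ->
  ln (\prod_(p <- s) f p) = \sum_(p <- s) ln (f p).
Proof.
elim: s => [|p s IH] f0; first by rewrite !big_nil ln1.
have f0' q : q \in s -> 0 < f q by move=> qs; apply: f0; rewrite inE qs orbT.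
rewrite !big_cons lnM ?posrE ?IH //; first by apply: f0; rewrite inE eqxx.
by rewrite big_seq; apply: prodr_gt0.
Qed.

Lemma ler_ln_nat m n : (0 < m)%N -> (m <= n)%N -> ln m%:R <= ln n%:R :> R.
Proof.
by move=> m0 mn; rewrite ler_ln ?posrE ?ltr0n ?ler_nat //; apply: leq_trans mn.
Qed.

Lemma ln_nat_ge0 n : 0 <= ln n%:R :> R.
Proof. by case: n => [|n]; [rewrite ln0 ?lexx|rewrite ln_ge0 // ler1n]. Qed.

Lemma sum_ln_primes_le m :
  \sum_(m.+1 <= p < (m + m).+1 | prime p) ln p%:R <= (m + m)%:R * ln 2 :> R.
Proof.
rewrite -big_filter; set s := [seq p <- index_iota m.+1 (m + m).+1 | prime p].
have sP p : p \in s -> prime p /\ (m < p <= m + m)%N.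
  by rewrite mem_filter mem_index_iota => /andP[].
have s1 : all prime s by apply/allP => p /sP[].
have s2 : (\prod_(p <- s) p %| 'C(m + m, m))%N.
  apply: prod_primes_dvdn => //; first by rewrite filter_uniq // iota_uniq.
  by apply/allP => p /sP[pp pm]; apply: prime_dvd_central_bin.
have C0 : (0 < 'C(m + m, m))%N by rewrite bin_gt0 leq_addr.
rewrite -ln_prod => [|p /sP[/prime_gt0]]; last by rewrite ltr0n.
rewrite -natr_prod mulr_natl -lnXn // -natrX.
apply: ler_ln_nat; first exact: prod_primes_gt0.
by apply: leq_trans (dvdn_leq C0 s2) _; apply: bin_le_exp2.
Qed.

(** The primes of a block (m, 2 m] divide the central binomial coefficient, which
    is at most 2^(2 m); the blocks add up geometrically. *)
Lemma chebyshev_theta_dyadic K :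
  \sum_(0 <= p < (2 ^ K).+1 | prime p) ln p%:R <= (2 ^ K.+1)%:R * ln 2 :> R.
Proof.
have l2 : 0 <= ln 2%:R :> R := ln_nat_ge0 2.
elim: K => [|K IH].
  rewrite big_mkcond !big_nat_recr //= big_geq //= !addr0.
  by rewrite mulr_ge0.
rewrite (big_cat_nat (leq0n (2 ^ K).+1)) /=; last first.
  by rewrite ltnS leq_pexp2l.
have e : (2 ^ K.+1 = 2 ^ K + 2 ^ K)%N by rewrite expnS mul2n addnn.
have h := sum_ln_primes_le (2 ^ K); rewrite -e in h.
apply: le_trans (lerD IH h) _.
by rewrite -mulrDl -natrD addnn -mul2n -expnS.
Qed.

(** The logarithm of the prime factorisation, over a range of primes that does not
    depend on m. *)
Lemma ln_logn N m : (0 < m <= N)%N ->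
  ln m%:R = \sum_(0 <= p < N.+1 | prime p) (logn p m)%:R * ln p%:R :> R.
Proof.
move=> /andP[m0 mN].
have e := widen_partn predT mN; rewrite (partnT m0) in e.
rewrite [in LHS]e natr_prod ln_prod => [|p _]; last first.
  rewrite natrX; case: p => [|p]; last by rewrite exprn_gt0.
  by rewrite lognE.
rewrite [RHS]big_mkcond /=; apply: eq_bigr => p _; case: ifP => pp.
  by rewrite natrX lnXn ?ltr0n ?prime_gt0 // mulr_natl.
by rewrite lognE pp expn0 ln1.
Qed.

Lemma ln_fact_logn N n : (n <= N)%N ->
  ln n`!%:R = \sum_(0 <= p < N.+1 | prime p) (logn p n`!)%:R * ln p%:R :> R.
Proof.
elim: n => [|n IH] nN.
  by rewrite fact0 ln1 big1 // => p _; rewrite logn1 mul0r.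
rewrite factS natrM lnM ?posrE ?ltr0n ?fact_gt0 // IH ?(ltnW nN) //.
rewrite (@ln_logn N) // -big_split /=; apply: eq_bigr => p _.
by rewrite lognM ?fact_gt0 // natrD mulrDl.
Qed.

(** The first term of Legendre's formula, and the whole geometric series that
    bounds it. *)
Lemma logn_fact_bounds p n : prime p ->
  n%:R / p%:R - 1 <= (logn p n`!)%:R :> R /\
  (logn p n`!)%:R <= n%:R / (p%:R - 1) :> R.
Proof.
move=> pp; rewrite logn_fact //.
have p0 : 0 < p%:R :> R by rewrite ltr0n prime_gt0.
have p1 : 0 < p%:R - 1 :> R by rewrite subr_gt0 ltr1n prime_gt1.
split.
  have h : n%:R / p%:R - 1 <= (n %/ p)%N%:R :> R.
    rewrite lerBlDr ler_pdivrMr // natr1 -natrM ler_nat.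
    by rewrite ltnW // ltn_ceil // prime_gt0.
  apply: le_trans h _; case: n => [|n]; first by rewrite div0n ler0n.
  by rewrite ler_nat big_nat_recl //= expn1 leq_addr.
have geo j : (p%:R - 1) * \sum_(1 <= k < j.+1) p%:R ^- k = 1 - p%:R ^- j :> R.
  elim: j => [|j IH]; first by rewrite big_geq // mulr0 expr0 invr1 subrr.
  rewrite big_nat_recr //= mulrDr IH exprS; field.
  by rewrite expf_neq0 ?gt_eqF.
apply: (@le_trans _ _ (n%:R * \sum_(1 <= k < n.+1) p%:R ^- k)).
  rewrite natr_sum mulr_sumr; apply: ler_sum => k _.
  rewrite ler_pdivlMr ?exprn_gt0 // -natrX -natrM ler_nat; exact: leq_divM.
apply: ler_wpM2l; first exact: ler0n.
rewrite -[leRHS]mul1r ler_pdivlMr // mulrC geo gerBl invr_ge0 exprn_ge0 // ltW.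
Qed.

Lemma ln_succ_le n : (0 < n)%N -> ln n.+1%:R - ln n%:R <= n%:R^-1 :> R.
Proof.
move=> n0; have nR : 0 < n%:R :> R by rewrite ltr0n.
rewrite -ln_div ?posrE ?ltr0n //.
have -> : n.+1%:R / n%:R = 1 + n%:R^-1 :> R.
  by rewrite -natr1 mulrDl divff ?gt_eqF // mul1r.
by apply: le_ln1Dx; apply: lt_trans (ltrN10 _) _; rewrite invr_gt0.
Qed.

Lemma ln_fact_ge n : n%:R * ln n%:R - n%:R <= ln n`!%:R :> R.
Proof.
elim: n => [|n IH]; first by rewrite mul0r subrr fact0 ln1.
rewrite factS natrM lnM ?posrE ?ltr0n ?fact_gt0 //.
have [->|n0] := posnP n; first by rewrite fact0 !ln1; lra.
have nR : 0 < n%:R :> R by rewrite ltr0n.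
have h := ln_succ_le n0.
have h2 : n%:R * (ln n.+1%:R - ln n%:R) <= 1 :> R.
  by rewrite mulrC -ler_pdivlMr // mul1r.
move: IH h2; rewrite -natr1; lra.
Qed.

Lemma ln_fact_le n : ln n`!%:R <= n%:R * ln n%:R :> R.
Proof.
elim: n => [|n IH]; first by rewrite mul0r fact0 ln1.
rewrite factS natrM lnM ?posrE ?ltr0n ?fact_gt0 //.
have -> : n.+1%:R * ln n.+1%:R = n%:R * ln n.+1%:R + ln n.+1%:R :> R.
  by rewrite -{1}natr1 mulrDl mul1r.
rewrite addrC lerD2r.
have [->|n0] := posnP n; first by rewrite fact0 ln1 mul0r.
by apply: le_trans IH _; rewrite ler_pM2l ?ltr0n // ler_ln_nat.
Qed.

(** Term by term, ln n / (n (n - 1)) is at most G (n - 1) - G n for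
    G n = (ln n + 2) / n, and G 1 = 2. *)
Lemma sum_ln_over_pronic N :
  \sum_(0 <= p < N.+1 | prime p) ln p%:R / (p%:R * (p%:R - 1)) <= 2 :> R.
Proof.
pose G n : R := (ln n%:R + 2) / n%:R.
have G0 n : 0 <= G n by rewrite divr_ge0 ?ler0n // addr_ge0 ?ln_nat_ge0.
have H M : \sum_(0 <= p < M.+2 | prime p) ln p%:R / (p%:R * (p%:R - 1)) <= G 1%N - G M.+1 :> R.
  elim: M => [|M IH].
    by rewrite big_mkcond !big_nat_recr //= big_geq //= !addr0 subrr.
  rewrite big_mkcond big_nat_recr //= -big_mkcond /=.
  set x := (if _ then _ else _).
  have m0 : 0 < M.+1%:R :> R by rewrite ltr0n.
  suff hx : x <= G M.+1 - G M.+2.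
    by apply: le_trans (lerD IH hx) _; rewrite addrA subrK.
  have e : M.+2%:R = M.+1%:R + 1 :> R by rewrite natr1.
  have hx : x <= ln M.+2%:R / (M.+2%:R * (M.+2%:R - 1)).
    have pos : 0 <= M.+2%:R * (M.+2%:R - 1) :> R.
      by rewrite e addrK mulr_ge0 ?addr_ge0 // ltW.
    by rewrite /x; case: ifP => // _; rewrite divr_ge0 ?ln_nat_ge0.
  apply: le_trans hx _.
  have h := @ln_succ_le M.+1 isT.
  have h2 : (M.+1%:R + 1) * (ln M.+2%:R - ln M.+1%:R) <= 2 :> R.
    have m1 : M.+1%:R^-1 <= 1 :> R by rewrite invf_le1 // ler1n.
    have m01 : 0 <= M.+1%:R + 1 :> R by lra.
    apply: le_trans (ler_wpM2l m01 h) _.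
    rewrite mulrDl mul1r divff ?gt_eqF //.
    by move: m1; move: (M.+1%:R^-1) => y; lra.
  rewrite /G e addrK; rewrite e in h2.
  have m1 : 0 < M.+1%:R + 1 :> R by lra.
  have -> (u v : R) : (u + 2) / M.+1%:R - (v + 2) / (M.+1%:R + 1) =
     ((M.+1%:R + 1) * (u + 2) - M.+1%:R * (v + 2)) / ((M.+1%:R + 1) * M.+1%:R).
    by move: (M.+1%:R) m0 m1 => t m0 m1; field; rewrite !gt_eqF.
  rewrite ler_pM2r ?invr_gt0 ?mulr_gt0 //.
  move: h2; move: (ln _) (ln _) => u v; move: (M.+1%:R) => t; lra.
have G1 : G 1%N = 2 by rewrite /G ln1 add0r divr1.
case: N => [|N]; first by rewrite big_mkcond big_nat_recr //= big_geq //= !addr0.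
by apply: le_trans (H N) _; rewrite G1 gerBl.
Qed.

(** Compare ln n!, for n = 2^K, with its prime factorisation.  Keeping only
    the first power of each prime and using Chebyshev's bound gives the upper
    estimate; bounding the exponents by n / (p - 1) gives the lower one. *)
Lemma mertens_first_dyadic K :
  `|\sum_(0 <= p < (2 ^ K).+1 | prime p) ln p%:R / p%:R - K%:R * ln 2| <= 3 :> R.
Proof.
set n := (2 ^ K)%N.
have n0 : 0 < n%:R :> R by rewrite ltr0n expn_gt0.
have lnn : ln n%:R = K%:R * ln 2 :> R by rewrite natrX lnXn // mulr_natl.
have l2 : ln 2 <= 1 :> R by have := @le_ln1Dx R 1; apply; lra.
set S := \sum_(_ <= _ < _ | _) _.
have E := ln_fact_logn (leqnn n).
have up : n%:R * S - (2 ^ K.+1)%:R * ln 2 <= ln n`!%:R.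
  apply: (@le_trans _ _ (\sum_(0 <= p < n.+1 | prime p) (n%:R / p%:R - 1) * ln p%:R)).
    have -> : \sum_(0 <= p < n.+1 | prime p) (n%:R / p%:R - 1) * ln p%:R =
       n%:R * S - \sum_(0 <= p < n.+1 | prime p) ln p%:R.
      rewrite /S mulr_sumr -sumrB; apply: eq_bigr => p _; ring.
    by rewrite lerD2l lerN2 chebyshev_theta_dyadic.
  rewrite E; apply: ler_sum => p pp; rewrite ler_wpM2r ?ln_nat_ge0 //.
  by have [] := logn_fact_bounds n pp.
have lo : ln n`!%:R <= n%:R * (S + 2).
  rewrite E; apply: (@le_trans _ _ (n%:R * (S + \sum_(0 <= p < n.+1 | prime p) ln p%:R / (p%:R * (p%:R - 1))))).
    rewrite -big_split /= mulr_sumr; apply: ler_sum => p pp.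
    have [_ h] := logn_fact_bounds n pp.
    apply: le_trans (ler_wpM2r (ln_nat_ge0 p) h) _.
    have p1 : 1 < p%:R :> R by rewrite ltr1n prime_gt1.
    rewrite le_eqVlt; apply/orP; left; apply/eqP; field.
    by rewrite subr_eq0 !gt_eqF //; lra.
  by rewrite ler_pM2l // lerD2l sum_ln_over_pronic.
have h1 := ln_fact_ge n; have h2 := ln_fact_le n.
rewrite lnn in h1 h2; move: up; rewrite expnS natrM => up.
rewrite ler_norml; apply/andP; split; rewrite -(ler_pM2l n0).
  nra.
nra.
Qed.

End RealSums.

(** * Dyadic blocks of primes against the harmonic series *)

Section DyadicComparison.
Context {R : realType}.
Implicit Types (n m p k K L : nat).

(** Summation by parts; the induction carries the boundary term
    U M * psi (M - 1), for U the partial sums of u. *)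
Lemma abel_inequality (u psi : nat -> R) K L (C : R) :
  (forall k, 0 <= psi k) -> (forall k, (K <= k)%N -> psi k.+1 <= psi k) ->
  (forall M, (K <= M)%N -> `|\sum_(K <= k < M) u k| <= C) ->
  `|\sum_(K <= k < L) u k * psi k| <= C * psi K.
Proof.
move=> psi0 psid uC; pose U M := \sum_(K <= k < M) u k.
have C0 : 0 <= C by apply: le_trans (uC K (leqnn K)); rewrite big_geq ?normr0.
have [LK|KL] := leqP L K; first by rewrite big_geq // normr0 mulr_ge0.
suff H j : `|\sum_(K <= k < (K + j).+1) u k * psi k - U (K + j).+1 * psi (K + j)%N| <= C * (psi K - psi (K + j)%N).
  have {H} := H (L - K.+1)%N; have -> : ((K + (L - K.+1)).+1 = L)%N by lia.
  set S := \sum_(_ <= _ < _) _; set x := psi (_ + _)%N => H.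
  rewrite -(subrK (U L * x) S); apply: le_trans (ler_normD _ _) _.
  have : `|U L * x| <= C * x.
    by rewrite normrM (ger0_norm (psi0 _)) ler_wpM2r // uC // ltnW.
  lra.
elim: j => [|j IH].
  by rewrite addn0 /U !big_nat1 !subrr normr0 mulr0.
have KJ : (K <= (K + j).+1)%N by lia.
have dpsi := psid (K + j)%N (leq_addr _ _).
rewrite addnS big_nat_recr //= /U [X in _ - X * _]big_nat_recr //= -/(U _).
set S := \sum_(_ <= _ < _) _ in IH *; set x := psi (K + j)%N in IH dpsi *.
set y := psi _ in dpsi *; set V := U _ in IH *.
have -> : S + u (K + j).+1 * y - (V + u (K + j).+1) * y = (S - V * x) + V * (x - y) by ring.
apply: le_trans (ler_normD _ _) _.
have : `|V * (x - y)| <= C * (x - y).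
  by rewrite normrM (ger0_norm (_ : 0 <= x - y)) ?subr_ge0 // ler_wpM2r ?subr_ge0 // uC.
lra.
Qed.

(** The power n^(-s); its value at n = 0 is 1, as ln 0 = 0. *)
Definition npow (s : R) (n : nat) : R := expR (- s * ln n%:R).

Lemma npow_gt0 s n : 0 < npow s n. Proof. exact: expR_gt0. Qed.

Lemma npow_le1 s n : 0 <= s -> npow s n <= 1.
Proof. by move=> s0; rewrite /npow expR_le1 mulNr oppr_le0 mulr_ge0 ?ln_nat_ge0. Qed.

Lemma npowM s m n : (0 < m)%N -> (0 < n)%N -> npow s (m * n) = npow s m * npow s n.
Proof.
by move=> m0 n0; rewrite /npow natrM lnM ?posrE ?ltr0n // mulrDr expRD.
Qed.

Lemma npow_le s m n : 0 <= s -> (0 < m)%N -> (m <= n)%N -> npow s n <= npow s m.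
Proof.
by move=> s0 m0 mn; rewrite ler_expR !mulNr lerN2 ler_wpM2l // ler_ln_nat.
Qed.

(** The term n^(-1-s) of the series of zeta(1+s); its value at n = 0 is 0. *)
Definition zterm (s : R) (n : nat) : R := npow s n / n%:R.

(** The logarithm of the Euler factor of zeta(1+s) at p. *)
Definition euler_log (s : R) (p : nat) : R := - ln (1 - zterm s p).

(** The mass 2^(-sk) / k against which the primes of (2^k, 2^(k+1)] are
    weighed; the sum of these over k >= 1 is - ln (1 - 2^(-s)). *)
Definition dyadic_mass (s : R) (k : nat) : R := npow s 2 ^+ k / k%:R.

Lemma zterm_ge0 s n : 0 <= zterm s n.
Proof. by rewrite divr_ge0 ?ler0n ?ltW ?npow_gt0. Qed.

Lemma zterm_le s n : 0 <= s -> zterm s n <= n%:R^-1.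
Proof. by move=> s0; rewrite -[leRHS]mul1r ler_wpM2r ?invr_ge0 ?ler0n ?npow_le1. Qed.

(** The error is at most 2 p^(-2), majorized here by a term that telescopes. *)
Lemma euler_log_approx s p : 0 <= s -> prime p ->
  zterm s p <= euler_log s p <= zterm s p + 2 * (p.-1%:R^-1 - p%:R^-1).
Proof.
move=> s0 pp; set x := zterm s p.
have x0 : 0 <= x := zterm_ge0 s p.
have xp : x <= p%:R^-1 := zterm_le p s0.
have p2 : p%:R^-1 <= 2^-1 :> R := inv_prime_le R pp.
rewrite /euler_log -/x; apply/andP; split.
  by rewrite lerNr; have := @le_ln1Dx R (- x); apply; lra.
have -> : - ln (1 - x) = ln (1 + x / (1 - x)).
  by rewrite -lnV ?posrE; [congr ln; field; lra|lra].
have x1 : 0 < 1 - x by lra.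
apply: le_trans (le_ln1Dx _) _.
  by apply: lt_le_trans (ltrN10 _) _; rewrite divr_ge0 // ltW.
have xx : x / (1 - x) <= x + 2 * x ^+ 2.
  rewrite ler_pdivrMr //; nra.
apply: le_trans xx _; rewrite lerD2l ler_pM2l //.
have p1 := prime_gt1 pp.
have xx : x ^+ 2 <= p%:R^-1 ^+ 2 by rewrite lerXn2r ?nnegrE ?invr_ge0 ?ler0n.
apply: le_trans xx _.
have e : p%:R = p.-1%:R + 1 :> R by rewrite natr1 prednK // prime_gt0.
have q0 : 0 < p.-1%:R :> R by rewrite ltr0n; lia.
rewrite e; move: (p.-1%:R) q0 => q q0.
have -> : q^-1 - (q + 1)^-1 = (q * (q + 1))^-1 by field; lra.
rewrite exprVn lef_pV2 ?posrE ?mulr_gt0 ?exprn_gt0 //; nra.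
Qed.

(** Writing p^(-1-s) as (ln p / p) * (p^(-s) / ln p), the second factor is
    decreasing in p and equals the dyadic mass, up to ln 2, at powers of two. *)
Lemma zterm_block_bounds s k p : 0 <= s -> (0 < k)%N -> (2 ^ k < p <= 2 ^ k.+1)%N ->
  ln p%:R / p%:R / ln 2 * dyadic_mass s k.+1 <= zterm s p <=
  ln p%:R / p%:R / ln 2 * dyadic_mass s k.
Proof.
move=> s0 k0 /andP[kp pk].
have l2 : 0 < ln 2 :> R by rewrite ln_gt0 // ltr1n.
have p0 : (0 < p)%N by lia.
have pR : 0 < p%:R :> R by rewrite ltr0n.
have e2 j : npow s 2 ^+ j = npow s (2 ^ j).
  by rewrite /npow natrX lnXn // mulrnAr -(mulr_natl (- s * ln 2%:R)) expRM_natl.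
have lnE j : ln (2 ^ j)%N%:R = j%:R * ln 2 :> R by rewrite natrX lnXn // mulr_natl.
have lk : k%:R * ln 2 <= ln p%:R :> R by rewrite -(lnE k) ler_ln_nat ?expn_gt0 // ltnW.
have lk1 : ln p%:R <= k.+1%:R * ln 2 :> R by rewrite -(lnE k.+1) ler_ln_nat.
have kR : 0 < k%:R :> R by rewrite ltr0n.
have k1R : 0 < k.+1%:R :> R by rewrite ltr0n.
have lp : 0 < ln p%:R :> R by apply: lt_le_trans lk; rewrite mulr_gt0.
rewrite /dyadic_mass !e2 /zterm.
have h1 : npow s (2 ^ k.+1) <= npow s p by apply: npow_le.
have h2 : npow s p <= npow s (2 ^ k) by apply: npow_le; rewrite ?expn_gt0 // ltnW.
have g j : ln p%:R / p%:R / ln 2 * (npow s (2 ^ j) / j%:R) =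
  npow s (2 ^ j) * (ln p%:R / (j%:R * ln 2)) / p%:R.
  by rewrite invfM; ring.
rewrite !g; apply/andP; split; rewrite ler_pM2r ?invr_gt0 //.
  apply: le_trans h1; apply: ler_piMr; first exact/ltW/npow_gt0.
  by rewrite ler_pdivrMr ?mulr_gt0 // mul1r.
apply: le_trans h2 _; apply: ler_peMr; first exact/ltW/npow_gt0.
by rewrite ler_pdivlMr ?mulr_gt0 // mul1r.
Qed.

Lemma dyadic_mass_ge0 s k : 0 <= dyadic_mass s k.
Proof. by rewrite divr_ge0 ?ler0n // exprn_ge0 // ltW ?npow_gt0. Qed.

Lemma dyadic_mass_anti s k : 0 <= s -> (0 < k)%N ->
  dyadic_mass s k.+1 <= dyadic_mass s k.
Proof.
move=> s0 k0; have n0 j : 0 <= npow s 2 ^+ j by rewrite exprn_ge0 // ltW ?npow_gt0.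
rewrite /dyadic_mass; apply: ler_pM; rewrite ?invr_ge0 ?ler0n //.
  by rewrite exprS ler_piMl ?npow_le1.
by rewrite lef_pV2 ?posrE ?ltr0n // ler_nat.
Qed.

Lemma dyadic_mass_le s k : 0 <= s -> dyadic_mass s k <= k%:R^-1.
Proof.
move=> s0; rewrite -[leRHS]mul1r ler_wpM2r ?invr_ge0 ?ler0n //.
by rewrite exprn_ile1 ?npow_le1 // ltW ?npow_gt0.
Qed.

Definition primes_sum (g : nat -> R) (K : nat) : R :=
  \sum_(0 <= p < (2 ^ K).+1 | prime p) g p.

Lemma primes_sum_block (g : nat -> R) (K L : nat) : (K <= L)%N ->
  primes_sum g L - primes_sum g K = \sum_((2 ^ K).+1 <= p < (2 ^ L).+1 | prime p) g p.
Proof.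
move=> KL; have h : ((2 ^ K).+1 <= (2 ^ L).+1)%N by rewrite ltnS leq_pexp2l.
by rewrite /primes_sum (big_cat_nat (leq0n _) h) /= addrAC subrr add0r.
Qed.

(** Let a k be the sum of ln p / p over the block (2^k, 2^(k+1)], divided by ln 2.
    The partial sums of a k - 1 are bounded by [mertens_first_dyadic], and the
    block sum of p^(-1-s) lies between a k times the masses at k + 1 and at k.
    Abel's inequality on both sides bounds the difference by O(1/K); the constant
    does not depend on s because the masses are at most 1 / k for every s >= 0. *)
Lemma euler_log_dyadic_tail : exists2 C : R, 0 <= C & forall s K L,
  0 <= s -> (0 < K <= L)%N ->
  `|(primes_sum (euler_log s) L - \sum_(1 <= k < L) dyadic_mass s k) -
    (primes_sum (euler_log s) K - \sum_(1 <= k < K) dyadic_mass s k)| <= C / K%:R.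
Proof.
have l2 : 0 < ln 2 :> R by rewrite ln_gt0 // ltr1n.
pose C2 : R := 6 / ln 2; have C20 : 0 <= C2 by rewrite divr_ge0 // ltW.
exists (C2 + 3) => [|s K L s0 /andP[K0 KL]]; first by rewrite addr_ge0.
have KR : 0 < K%:R :> R by rewrite ltr0n.
pose a k : R := (primes_sum (fun p => ln p%:R / p%:R) k.+1 - primes_sum (fun p => ln p%:R / p%:R) k) / ln 2.
have tel (f : nat -> R) M : (K <= M)%N -> \sum_(K <= k < M) (f k.+1 - f k) = f M - f K.
  by move=> KM; rewrite telescope_sumr.
pose Z := primes_sum (zterm s).
pose Y k := Z k.+1 - Z k.
have hY k : (K <= k)%N -> a k * dyadic_mass s k.+1 <= Y k <= a k * dyadic_mass s k.
  move=> Kk; rewrite /a /Y /Z !primes_sum_block // -!mulrA !mulr_suml.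
  have zb p : ((2 ^ k).+1 <= p < (2 ^ k.+1).+1)%N && prime p -> _ :=
    fun h => zterm_block_bounds s0 (leq_trans K0 Kk) (proj1 (andP h)).
  by apply/andP; split; rewrite big_nat_cond [leRHS]big_nat_cond;
     apply: ler_sum => p /zb /andP[]; rewrite -!mulrA.
have hA M : (K <= M)%N -> `|\sum_(K <= k < M) (a k - 1)| <= C2.
  move=> KM; rewrite sumrB -mulr_suml tel // sumr_const_nat.
  have h1 := @mertens_first_dyadic R M; have h2 := @mertens_first_dyadic R K.
  rewrite -!/(primes_sum (fun p => ln p%:R / p%:R) _) in h1 h2.
  set x := primes_sum _ M in h1 *; set y := primes_sum _ K in h2 *.
  have -> : (x - y) / ln 2 - 1 *+ (M - K) = ((x - M%:R * ln 2) - (y - K%:R * ln 2)) / ln 2.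
    by rewrite natrB //; field; rewrite gt_eqF.
  rewrite normrM normfV (gtr0_norm l2) ler_pM2r ?invr_gt0 //.
  apply: le_trans (ler_normB _ _) _; lra.
have hAbel := abel_inequality L (dyadic_mass_ge0 s) (fun k Kk => dyadic_mass_anti s0 (leq_trans K0 Kk)) hA.
have hAbel' := abel_inequality (psi := fun k => dyadic_mass s k.+1) L (fun k => dyadic_mass_ge0 s k.+1)
   (fun k Kk => dyadic_mass_anti s0 (ltn0Sn k)) hA.
have mK : dyadic_mass s K <= K%:R^-1 := dyadic_mass_le K s0.
have mK1 : dyadic_mass s K.+1 <= K%:R^-1.
  by apply: le_trans mK; apply: dyadic_mass_anti.
have hZ : `|Z L - Z K - \sum_(K <= k < L) dyadic_mass s k| <= (C2 + 1) / K%:R.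
  rewrite -(tel Z) // -sumrB; rewrite ler_norml; apply/andP; split.
    apply: (@le_trans _ _ (\sum_(K <= k < L) ((a k - 1) * dyadic_mass s k.+1 + (dyadic_mass s k.+1 - dyadic_mass s k)))).
      rewrite big_split /= tel //.
      move: hAbel'; rewrite ler_norml => /andP[h _].
      have h2 := dyadic_mass_ge0 s L.
      have : C2 * dyadic_mass s K.+1 <= C2 / K%:R by rewrite ler_wpM2l.
      rewrite mulrDl mul1r; lra.
    rewrite big_nat_cond [leRHS]big_nat_cond; apply: ler_sum => k /andP[/andP[Kk _] _].
    have /andP[h _] := hY k Kk; rewrite /Y in h; lra.
  apply: (@le_trans _ _ (\sum_(K <= k < L) ((a k - 1) * dyadic_mass s k))).
    rewrite big_nat_cond [leRHS]big_nat_cond; apply: ler_sum => k /andP[/andP[Kk _] _].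
    have /andP[_ h] := hY k Kk; rewrite /Y in h; lra.
  move: hAbel; rewrite ler_norml => /andP[_ h].
  have : C2 * dyadic_mass s K <= C2 / K%:R by rewrite ler_wpM2l.
  have : 0 <= K%:R^-1 :> R by rewrite invr_ge0 ltW.
  rewrite mulrDl mul1r; lra.
have hE : 0 <= (primes_sum (euler_log s) L - primes_sum (euler_log s) K) - (Z L - Z K) <= 2 / K%:R.
  rewrite /Z !primes_sum_block // -sumrB; apply/andP; split.
    by apply: sumr_ge0 => p pp; have /andP[] := euler_log_approx s0 pp; lra.
  apply: (@le_trans _ _ (\sum_((2 ^ K).+1 <= p < (2 ^ L).+1) 2 * (p.-1%:R^-1 - p%:R^-1))).
    rewrite big_mkcond /= big_nat_cond [leRHS]big_nat_cond.
    apply: ler_sum => p /andP[/andP[p1 _] _]; case: ifP => pp.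
      have /andP[_ h] := euler_log_approx s0 pp; lra.
    rewrite mulr_ge0 // subr_ge0 lef_pV2 ?posrE ?ltr0n ?ler_nat ?leq_pred //.
      by apply: leq_ltn_trans p1.
    by rewrite -subn1 subn_gt0; apply: leq_ltn_trans p1; rewrite expn_gt0.
  rewrite -mulr_sumr ler_pM2l // big_add1 /=.
  under eq_bigr do rewrite -opprB.
  rewrite sumrN telescope_sumr ?leq_pexp2l // opprB.
  have : 0 <= (2 ^ L)%N%:R^-1 :> R by rewrite invr_ge0 ler0n.
  have : (2 ^ K)%N%:R^-1 <= K%:R^-1 :> R.
    by rewrite lef_pV2 ?posrE ?ltr0n ?expn_gt0 // ler_nat ltnW // ltn_expl.
  lra.
have sumE : \sum_(1 <= k < L) dyadic_mass s k - \sum_(1 <= k < K) dyadic_mass s k = \sum_(K <= k < L) dyadic_mass s k.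
  by rewrite (big_cat_nat K0 KL) /= addrAC subrr add0r.
move: hE hZ; rewrite !ler_norml -sumE => /andP[e1 e2] /andP[z1 z2].
have c3 : (C2 + 3) / K%:R = (C2 + 1) / K%:R + 2 / K%:R by rewrite -mulrDl; congr (_ / _); lra.
by apply/andP; split; rewrite c3; lra.
Qed.

End DyadicComparison.

(** * Euler products and smooth numbers *)

Local Open Scope classical_set_scope.
Local Open Scope ring_scope.

Definition smooth (N n : nat) : bool := all (fun p => p <= N)%N (primes n).

Lemma smooth_leq (N n : nat) : (n <= N)%N -> smooth N n.
Proof.
move=> nN; apply/allP => p; rewrite mem_primes => /and3P[_ n0 pn].
exact: leq_trans (dvdn_leq n0 pn) nN.
Qed.

Lemma smooth_mul (N m n : nat) : (0 < m)%N -> (0 < n)%N ->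
  smooth N (m * n) = smooth N m && smooth N n.
Proof.
move=> m0 n0; rewrite /smooth; apply/idP/andP => [/allP h|[/allP h1 /allP h2]].
  by split; apply/allP => p pm; apply: h; rewrite primesM // pm ?orbT.
by apply/allP => p; rewrite primesM // => /orP[/h1|/h2].
Qed.

Lemma smooth_prime (N p : nat) : prime p -> (p <= N)%N -> smooth N p.
Proof. by move=> pp pN; rewrite /smooth primes_prime //= pN. Qed.

Lemma smoothS (N n : nat) : ~~ (N.+1 %| n)%N -> smooth N.+1 n = smooth N n.
Proof.
move=> h; apply/idP/idP => /allP H; apply/allP => p pn; last exact/leqW/H.
have := H p pn; rewrite leq_eqVlt => /orP[/eqP e|//].
by move: pn; rewrite e mem_primes (negbTE h) !andbF.
Qed.

Lemma smoothS_composite (N n : nat) : ~~ prime N.+1 -> smooth N.+1 n = smooth N n.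
Proof.
move=> h; apply/idP/idP => /allP H; apply/allP => p pn; last exact/leqW/H.
have := H p pn; rewrite leq_eqVlt => /orP[/eqP e|//].
by move: pn; rewrite e mem_primes (negbTE h).
Qed.

(** The value 0 at 0 lets sums start from index 0. *)
Definition mult_weight (R : realType) (h : nat -> R) : Prop :=
  [/\ h 0%N = 0, h 1%N = 1, forall n, 0 <= h n,
      forall m n, (0 < m)%N -> (0 < n)%N -> h (m * n)%N = h m * h n &
      forall p, prime p -> h p < 1].

Section EulerProduct.
Context {R : realType}.
Implicit Types (h : nat -> R).

Definition smooth_sum h (N X : nat) : R := \sum_(n < X.+1 | smooth N n) h n.

Definition euler_product h (N : nat) : R := \prod_(0 <= p < N.+1 | prime p) (1 - h p)^-1.

Lemma euler_product0 h : euler_product h 0 = 1.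
Proof. by rewrite /euler_product big_mkcond big_nat1. Qed.

Lemma euler_productS h N : euler_product h N.+1 =
  euler_product h N * (if prime N.+1 then (1 - h N.+1)^-1 else 1).
Proof. by rewrite /euler_product big_mkcond big_nat_recr //= -big_mkcond. Qed.

Lemma smooth_sum_mono h N : mult_weight h ->
  {homo smooth_sum h N : x y / (x <= y)%N >-> x <= y}.
Proof.
move=> [_ _ h_ge0 _ _] X Y XY; rewrite /smooth_sum -!(big_mkord (smooth N) h).
rewrite [leRHS](big_cat_nat (leq0n X.+1)) //= lerDl.
by apply: sumr_ge0 => n _.
Qed.

(** A number that is smooth up to the prime N + 1 either is not divisible by
    N + 1, and is then smooth up to N, or is N + 1 times a smooth number. *)
Lemma smooth_sum_rec h N X : mult_weight h -> prime N.+1 ->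
  smooth_sum h N.+1 X =
  smooth_sum h N X + h N.+1 * smooth_sum h N.+1 (X %/ N.+1)%N.
Proof.
move=> [h_0 h_1 h_ge0 hM h_prime] pp.
rewrite /smooth_sum (bigID (fun n : 'I__ => (n %% N.+1 == 0)%N)) /= addrC.
congr (_ + _).
  rewrite [RHS](bigID (fun n : 'I__ => (n %% N.+1 == 0)%N)) /=.
  rewrite [X in _ = X + _]big1 ?add0r => [|n /andP[sn dn]]; last first.
    have [->|n0] := posnP n; first exact: h_0.
    have /allP := sn; move/(_ N.+1); rewrite mem_primes pp n0 /= => /(_ dn).
    by rewrite ltnn.
  by apply: eq_bigl => n; case dn: (_ == _); rewrite ?andbF // !andbT smoothS // /dvdn dn.
pose f n := if smooth N.+1 n then h n else 0.
transitivity (\sum_(n < X.+1 | (n %% N.+1 == 0)%N) f n).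
  by rewrite [RHS]big_mkcond [LHS]big_mkcond /=; apply: eq_bigr => n _; rewrite /f; case: (smooth _ _); case: (_ == _).
have e : ((X.+1 + (N.+1.-1 - 0)) %/ N.+1 = (X %/ N.+1).+1)%N.
  by rewrite subn0 /= addSnnS divnDr ?dvdnn // divnn addn1.
rewrite (sum_residue_class _ f (ltn0Sn N)) e.
rewrite [in RHS]big_mkcond mulr_sumr; apply: eq_bigr => k _; rewrite add0n /f.
have [->|k0] := posnP k; first by rewrite muln0 h_0; case: (smooth _ _); rewrite mulr0.
rewrite smooth_mul // smooth_prime //= hM //.
by case: ifP; rewrite ?mulr0.
Qed.

Lemma smooth_sum0 h X : mult_weight h -> (0 < X)%N -> smooth_sum h 0 X = 1.
Proof.
move=> [h_0 h_1 _ _ _]; case: X => // X _.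
rewrite /smooth_sum -(big_mkord (smooth 0) h) big_mkcond !big_nat_recl //= h_0 add0r h_1.
rewrite big1 ?addr0 // => n _; case: ifP => // /allP /(_ (pdiv n.+2)).
rewrite mem_primes pdiv_prime // pdiv_dvd /= => /(_ isT).
by rewrite leqNgt pdiv_gt0.
Qed.

Lemma smooth_sumS_composite h N X : ~~ prime N.+1 ->
  smooth_sum h N.+1 X = smooth_sum h N X.
Proof. by move=> pN; apply: eq_bigl => n; rewrite smoothS_composite. Qed.

Lemma smooth_sum_le h N X : mult_weight h -> smooth_sum h N X <= euler_product h N.
Proof.
move=> mh; elim: N X => [|N IH] X.
  by rewrite euler_product0 -(@smooth_sum0 h X.+1) // smooth_sum_mono.
rewrite euler_productS; case: ifP => pN; last first.
  by rewrite mulr1 smooth_sumS_composite ?pN.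
have [_ _ h_ge0 _ /(_ _ pN) h1] := mh.
rewrite ler_pdivlMr ?subr_gt0 // mulrBr mulr1 lerBlDr.
rewrite {1}smooth_sum_rec // lerD // mulrC ler_wpM2r //.
by apply: smooth_sum_mono => //; apply: leq_div.
Qed.

(** The smooth sums increase and are bounded by [smooth_sum_le], hence converge;
    evaluating the recursion of [smooth_sum_rec] along multiples of N + 1
    determines the limit. *)
Lemma smooth_sum_cvg h N : mult_weight h ->
  smooth_sum h N X @[X --> \oo] --> euler_product h N.
Proof.
move=> mh; elim: N => [|N IH].
  rewrite euler_product0; apply: cvg_near_cst; exists 1%N => // X /= X0.
  by rewrite smooth_sum0.
rewrite euler_productS; case: ifP => pN; last first.
  by rewrite mulr1; under eq_fun do rewrite smooth_sumS_composite ?pN //.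
have [_ _ h_ge0 _ /(_ _ pN) h1] := mh.
have cv : cvgn (smooth_sum h N.+1).
  apply: nondecreasing_is_cvgn; first exact: smooth_sum_mono.
  by exists (euler_product h N.+1) => _ [X _ <-]; apply: smooth_sum_le.
pose l := limn (smooth_sum h N.+1).
have c1 : smooth_sum h N.+1 (N.+1 * Y)%N @[Y --> \oo] --> l.
  exact: (@cvg_comp _ _ _ (muln N.+1) (smooth_sum h N.+1) _ _ _ (cvg_mulnl _ (ltn0Sn N)) cv).
have c2 : smooth_sum h N.+1 (N.+1 * Y)%N @[Y --> \oo] --> euler_product h N + h N.+1 * l.
  under eq_fun do rewrite smooth_sum_rec // mulKn //.
  apply: cvgD; first exact: (@cvg_comp _ _ _ (muln N.+1) (smooth_sum h N) _ _ _ (cvg_mulnl _ (ltn0Sn N)) IH).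
  exact: cvgZr.
have e : l = euler_product h N + h N.+1 * l by exact: (cvg_unique _ c1 c2).
have -> : euler_product h N / (1 - h N.+1) = l.
  apply: (mulIf (_ : 1 - h N.+1 != 0)); first by rewrite subr_eq0 gt_eqF.
  by rewrite divfK ?subr_eq0 ?gt_eqF // mulrBr mulr1 {1}e mulrC addrK.
exact: cv.
Qed.

(** Every n <= N is smooth up to N, and the smooth sums are part of the full
    sum. *)
Lemma euler_product_bounds h N (Z : R) : mult_weight h ->
  (forall X, \sum_(n < X.+1) h n <= Z) ->
  \sum_(n < N.+1) h n <= euler_product h N <= Z.
Proof.
move=> mh hZ; apply/andP; split.
  apply: le_trans (smooth_sum_le N N mh).
  rewrite le_eqVlt; apply/orP; left; apply/eqP; apply: eq_bigl => n.
  by rewrite smooth_leq // -ltnS.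
apply: (cvgr_to_le (smooth_sum_cvg (N := N) mh)); apply: nearW => X.
apply: le_trans (hZ X); rewrite /smooth_sum big_mkcond; apply: ler_sum => n _.
by case: ifP => // _; case: mh.
Qed.

End EulerProduct.

(** * Zeta near 1 and the logarithmic series *)

Section Zeta.
Context {R : realType}.
Implicit Types (s x : R) (n m p k K X : nat).

Lemma zterm_mult_weight s : 0 <= s -> mult_weight (zterm s).
Proof.
move=> s0; split.
- by rewrite /zterm invr0 mulr0.
- by rewrite /zterm /npow ln1 mulr0 expR0 divr1.
- by move=> n; apply: zterm_ge0.
- by move=> m n m0 n0; rewrite /zterm npowM // natrM invfM mulrACA.
- move=> p pp; apply: le_lt_trans (zterm_le p s0) _.
  by apply: le_lt_trans (inv_prime_le R pp) _; rewrite invf_lt1 // ltr1n.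
Qed.

Lemma npow1 s : npow s 1 = 1.
Proof. by rewrite /npow ln1 mulr0 expR0. Qed.

Lemma ln_succ_ge m : (0 < m)%N -> m.+1%:R^-1 <= ln m.+1%:R - ln m%:R :> R.
Proof.
move=> m0; have mR : 0 < m%:R :> R by rewrite ltr0n.
have m1R : 0 < m.+1%:R :> R by rewrite ltr0n.
rewrite -opprB lerNr -ln_div ?posrE //.
have -> : m%:R / m.+1%:R = 1 + - m.+1%:R^-1 :> R.
  by rewrite -(natr1 m); field; rewrite natr1 gt_eqF.
by apply: le_ln1Dx; rewrite ltrN2 invf_lt1 // ltr1n.
Qed.

(** Both come from exp t >= 1 + t, applied to the quotients of consecutive
    powers; they make s n^(-1-s) comparable with differences of n^(-s). *)
Lemma npow_succ_bounds s m : 0 <= s -> (0 < m)%N ->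
  npow s m.+1 * (1 + s / m.+1%:R) <= npow s m /\
  npow s m * (1 - s / m%:R) <= npow s m.+1.
Proof.
move=> s0 m0.
have h1 := ln_succ_ge m0; have h2 := @ln_succ_le R m m0.
set d := ln m.+1%:R - ln m%:R in h1 h2.
have e1 : npow s m = npow s m.+1 * expR (s * d).
  by rewrite /npow -expRD /d; congr expR; ring.
have e2 : npow s m.+1 = npow s m * expR (- (s * d)).
  by rewrite /npow -expRD /d; congr expR; ring.
split.
  rewrite [leRHS]e1 ler_pM2l ?npow_gt0 //; apply: le_trans (expR_ge1Dx _).
  by rewrite lerD2l ler_wpM2l.
rewrite [leRHS]e2 ler_pM2l ?npow_gt0 //; apply: le_trans (expR_ge1Dx _).
by rewrite lerD2l lerN2 ler_wpM2l.
Qed.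

Lemma zterm_div s n : 0 < s -> zterm s n = npow s n * (s / n%:R) / s.
Proof. by move=> s0; rewrite /zterm -mulrA; congr (_ * _); rewrite mulrC mulKf ?gt_eqF. Qed.

Lemma zeta_partial_le s X : 0 < s -> \sum_(n < X.+1) zterm s n <= 1 + s^-1.
Proof.
move=> s0; have [z0 z1 _ _ _] := zterm_mult_weight (ltW s0).
have si : 0 < s^-1 by rewrite invr_gt0.
case: X => [|X]; first by rewrite big_ord1 z0; lra.
suff H : \sum_(n < X.+2) zterm s n <= 1 + (1 - npow s X.+1) / s.
  apply: le_trans H _; rewrite lerD2l -[leRHS]mul1r ler_pM2r // gerBl ltW ?npow_gt0 //.
elim: X => [|X IH].
  by rewrite !big_ord_recl big_ord0 /= z0 z1 npow1 subrr mul0r !addr0 add0r.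
rewrite big_ord_recr /=; apply: le_trans (lerD IH (lexx _)) _.
have [h _] := npow_succ_bounds (ltW s0) (ltn0Sn X).
rewrite -addrA lerD2l zterm_div // -mulrDl ler_pM2r ?invr_gt0 //.
by move: h; rewrite mulrDr mulr1; move: (_ * (s / _)) => y; lra.
Qed.

Lemma zeta_partial_ge s X : 0 < s ->
  (1 - npow s X.+1) / s <= \sum_(n < X.+1) zterm s n.
Proof.
move=> s0; have [z0 z1 _ _ _] := zterm_mult_weight (ltW s0).
elim: X => [|X IH]; first by rewrite big_ord1 z0 npow1 subrr mul0r.
rewrite big_ord_recr /=; apply: le_trans (lerD IH (lexx _)).
have [_ h] := npow_succ_bounds (ltW s0) (ltn0Sn X).
rewrite zterm_div // -mulrDl ler_pM2r ?invr_gt0 //.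
by move: h; rewrite mulrBr mulr1; move: (_ * (s / _)) => y; lra.
Qed.

(** The Taylor polynomial of - ln (1 - t) at 0. *)
Definition ln1B_poly (n : nat) : R -> R := fun t => \sum_(k < n) t ^+ k.+1 / k.+1%:R.

Lemma is_derive_ln1B_poly n (t : R) :
  is_derive t 1 (ln1B_poly n) (\sum_(k < n) t ^+ k).
Proof.
elim: n => [|n IH].
  rewrite big_ord0; have -> : ln1B_poly 0 = cst 0.
    by apply/funext => u; rewrite /ln1B_poly big_ord0.
  exact: is_derive_cst.
have hX := is_deriveZ n.+1%:R^-1 (is_deriveX n.+1 (is_derive_id t (1 : R))).
have -> : ln1B_poly n.+1 = ln1B_poly n + (n.+1%:R^-1 \*: (id ^+ n.+1 : R -> R)).
  apply/funext => u; rewrite /ln1B_poly big_ord_recr /=.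
  by rewrite [in RHS]/GRing.add /= exprfctE mulrC.
rewrite big_ord_recr /=; apply: is_deriveD.
have -> : t ^+ n = n.+1%:R^-1 *: ((n.+1%:R * t ^+ n) *: (1 : R)).
  by rewrite scalerA mulKf ?pnatr_eq0 // [RHS]mulr1.
exact: hX.
Qed.

(** The derivative of - ln (1 - t) minus its Taylor polynomial of degree n is
    t^n / (1 - t); apply the mean value theorem on [0, x]. *)
Lemma ln1B_series K x : 0 <= x < 1 -> (0 < K)%N ->
  0 <= - ln (1 - x) - \sum_(1 <= k < K) x ^+ k / k%:R <= x ^+ K.-1 / (1 - x).
Proof.
case: K => // n /andP[x0 x1] _ /=.
rewrite big_add1 /= big_mkord -/(ln1B_poly n x).
pose f : R -> R := (fun t => - ln (1 - t)) - ln1B_poly n.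
pose df (t : R) : R := (1 - t)^-1 - \sum_(k < n) t ^+ k.
have fd (t : R) : t < 1 -> is_derive t 1 f (df t).
  move=> t1; apply: is_deriveB; last exact: is_derive_ln1B_poly.
  have d1 : is_derive t 1 (fun u : R => 1 - u) (- 1).
    have -> : (fun u : R => 1 - u) = cst 1 - id by apply/funext.
    by apply: is_derive_eq; rewrite sub0r.
  have t0 : 0 < 1 - t by rewrite subr_gt0.
  have := is_deriveN (@is_derive1_comp R (@ln R) (fun u => 1 - u) t _ _ (is_derive1_ln t0) d1).
  by rewrite mulrN1 opprK.
have dfE (t : R) : t < 1 -> df t = t ^+ n / (1 - t).
  move=> t1; have tn : 1 - t != 0 by rewrite subr_eq0 gt_eqF.
  apply: (mulIf tn); rewrite divfK // /df mulrBl mulVf // [_ * (1 - t)]mulrC.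
  by rewrite -[1 - t]opprB mulNr -subrX1 opprK addrC subrK.
have [c] : exists2 c, c \in `[0, x]%R & f x - f 0 = df c * (x - 0).
  apply: MVT_segment => //.
    by move=> t; rewrite in_itv /= => /andP[_ tx]; apply: fd; apply: lt_trans x1.
  apply: derivable_within_continuous => t; rewrite in_itv /= => /andP[_ tx].
  by have [] := fd t (le_lt_trans tx x1).
rewrite in_itv /= => /andP[c0 cx].
have f0 : f 0 = 0.
  rewrite [LHS](_ : _ = - ln (1 - 0) - ln1B_poly n 0) // subr0 ln1 oppr0 sub0r.
  by rewrite /ln1B_poly big1 ?oppr0 // => k _; rewrite expr0n mul0r.
have c1 : c < 1 by apply: le_lt_trans x1.
rewrite f0 !subr0 dfE // [f x](_ : _ = - ln (1 - x) - ln1B_poly n x) // => ->.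
have c1' : 0 < 1 - c by rewrite subr_gt0.
rewrite mulr_ge0 ?divr_ge0 ?exprn_ge0 ?(ltW c1') //=.
have x1' : 0 < 1 - x by rewrite subr_gt0.
rewrite -[leRHS]mulr1; apply: ler_pM => //; last exact: ltW.
  by rewrite divr_ge0 ?exprn_ge0 ?(ltW c1').
apply: ler_pM; rewrite ?exprn_ge0 ?invr_ge0 ?(ltW c1') //.
  by rewrite lerXn2r.
by rewrite lef_pV2 ?posrE // lerD2l lerN2.
Qed.

(** The logarithm of the Euler product of zeta(1+s) over p <= 2^K, caught between
    the partial sum up to 2^K and a bound for the whole series. *)
Lemma euler_sum_bounds s K : 0 < s ->
  ln ((1 - npow s (2 ^ K).+1) / s) <= primes_sum (euler_log s) K <= ln (1 + s^-1).
Proof.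
move=> s0; have mh := zterm_mult_weight (ltW s0).
have [_ _ _ _ h1] := mh.
have E : expR (primes_sum (euler_log s) K) = euler_product (zterm s) (2 ^ K).
  rewrite /primes_sum expR_sum; apply: eq_bigr => p pp.
  by rewrite /euler_log expRN lnK // posrE subr_gt0 h1.
have /andP[b1 b2] := euler_product_bounds (2 ^ K) mh (fun X => zeta_partial_le X s0).
have b0 := zeta_partial_ge (2 ^ K) s0.
rewrite -(expRK (primes_sum _ _)) E.
have a0 : 0 < (1 - npow s (2 ^ K).+1) / s.
  rewrite divr_gt0 // subr_gt0 /npow expR_lt1 mulNr oppr_lt0 mulr_gt0 //.
  by rewrite ln_gt0 // ltr1n ltnS expn_gt0.
have p0 : 0 < euler_product (zterm s) (2 ^ K) by apply: lt_le_trans b1; apply: lt_le_trans b0.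
have s1 : 0 < 1 + s^-1 by rewrite addr_gt0 ?invr_gt0.
by rewrite !ler_ln ?posrE // b2 andbT (le_trans b0).
Qed.
End Zeta.

(** * The gap between prime sums and harmonic sums *)

Section Mertens.
Context {R : realType}.
Implicit Types (s x : R) (n m p k K L N : nat).

(** The mass of the primes minus the comparison mass, up to 2^K. *)
Definition mertens_gap s K : R :=
  primes_sum (euler_log s) K - \sum_(1 <= k < K) dyadic_mass s k.

Lemma le_geometric_slack (a b c y : R) K : 0 <= y < 1 ->
  (forall L, (K <= L)%N -> a <= b + c * y ^+ L) -> a <= b.
Proof.
move=> /andP[y0 y1] H.
have cv : (b + c * y ^+ L) @[L --> \oo] --> b.
  rewrite -[X in _ --> X]addr0; apply: cvgD; first exact: cvg_cst.
  rewrite -[X in _ --> X](mulr0 c); apply: cvgM; first exact: cvg_cst.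
  by apply: cvg_expr; rewrite ger0_norm.
by apply: (cvgr_to_ge cv); exists K.
Qed.

(** Pass from K to a large L by [euler_log_dyadic_tail]; there the gap is close to
    ln zeta(1+s) + ln (1 - 2^(-s)), which is ln ln 2 + O(s) because
    s zeta(1+s) and (1 - 2^(-s)) / s tend to 1 and ln 2.  The dependence on L is
    a multiple of 2^(-sL) and disappears as L grows. *)
Lemma mertens_gap_bound : exists2 C : R, 0 <= C & forall s K, 0 < s -> (0 < K)%N ->
  `|mertens_gap s K - ln (ln 2)| <= s + C / K%:R.
Proof.
have [C C0 HC] := @euler_log_dyadic_tail R; exists C => // s K s0 K0.
have l2 : 0 < ln 2 :> R by rewrite ln_gt0 // ltr1n.
have l21 : ln 2 <= 1 :> R by have := @le_ln1Dx R 1; apply; lra.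
set y := npow s 2; pose u := s * ln 2.
have u0 : 0 < u by rewrite mulr_gt0.
have yE : y = expR (- u) by rewrite /y /npow /u mulNr.
have y0 : 0 < y by exact: npow_gt0.
have y1 : y < 1 by rewrite yE expR_lt1 oppr_lt0.
have y1' : 0 < 1 - y by rewrite subr_gt0.
have yu : 1 - y <= u by rewrite yE; have := expR_ge1Dx (- u); lra.
have yu' : u / (1 + u) <= 1 - y.
  have u1 : 0 < 1 + u by lra.
  have : y <= (1 + u)^-1.
    rewrite yE expRN lef_pV2 ?posrE ?expR_gt0 //; exact: expR_ge1Dx.
  have -> : u / (1 + u) = 1 - (1 + u)^-1 by field; rewrite gt_eqF.
  lra.
have y01 : 0 <= y < 1 by rewrite ltW.
have ser L : (K <= L)%N -> 0 <= - ln (1 - y) - \sum_(1 <= k < L) dyadic_mass s k <= y^-1 / (1 - y) * y ^+ L.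
  move=> KL; have L0 : (0 < L)%N by apply: leq_trans KL.
  have -> : y^-1 / (1 - y) * y ^+ L = y ^+ L.-1 / (1 - y).
    by rewrite -{1}(prednK L0) exprS; field; rewrite !gt_eqF.
  exact: ln1B_series.
have tail L : (K <= L)%N -> `|mertens_gap s L - mertens_gap s K| <= C / K%:R.
  by move=> KL; apply: HC; rewrite ?ltW // K0.
have s1 : 0 < 1 + s^-1 by rewrite addr_gt0 ?invr_gt0.
have up : mertens_gap s K <= ln (1 + s^-1) + ln (1 - y) + C / K%:R.
  apply: (@le_geometric_slack _ _ (y^-1 / (1 - y)) y K) => // L KL.
  have /andP[_ h1] := euler_sum_bounds L s0.
  have /andP[_ h2] := ser L KL.
  have := tail L KL; rewrite ler_norml => /andP[h3 _].
  by move: h3; rewrite {1}/mertens_gap; lra.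
have lo : - ln s + ln (1 - y) <= mertens_gap s K + C / K%:R.
  apply: (@le_geometric_slack _ _ (1 - y)^-1 y K) => // L KL.
  have L0 : (0 < L)%N by apply: leq_trans KL.
  have /andP[h1 _] := euler_sum_bounds L s0.
  have /andP[h2 _] := ser L KL.
  have := tail L KL; rewrite ler_norml => /andP[_ h3].
  have yL : y ^+ L <= y by rewrite -[leRHS]expr1 ler_wiXn2l // ltW.
  have yL0 : 0 < y ^+ L by rewrite exprn_gt0.
  have np : npow s (2 ^ L).+1 <= y ^+ L.
    apply: (@le_trans _ _ (npow s (2 ^ L))).
      by apply: npow_le; rewrite ?expn_gt0 // ltW.
    by rewrite /y /npow natrX lnXn // mulrnAr -(mulr_natl (- s * ln 2%:R)) expRM_natl.
  have h4 : - ln s - (1 - y)^-1 * y ^+ L <= ln ((1 - npow s (2 ^ L).+1) / s).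
    have z0 : 0 < 1 - npow s (2 ^ L).+1 by lra.
    rewrite ln_div ?posrE // addrC lerD2r.
    have h5 : ln (1 - y ^+ L) <= ln (1 - npow s (2 ^ L).+1).
      by rewrite ler_ln ?posrE; lra.
    apply: le_trans h5; rewrite lerNl.
    have z1 : 0 < 1 - y ^+ L by lra.
    rewrite -lnV ?posrE //.
    have -> : (1 - y ^+ L)^-1 = 1 + y ^+ L / (1 - y ^+ L) by field; rewrite gt_eqF.
    apply: le_trans (le_ln1Dx _) _.
      by apply: lt_le_trans (ltrN10 _) _; rewrite divr_ge0 // ltW.
    rewrite mulrC ler_pM2r // lef_pV2 ?posrE //; lra.
  by move: h3; rewrite {1}/mertens_gap; lra.
have su : u <= s by rewrite /u ler_piMr // ltW.
have e1 : ln (1 + s^-1) + ln (1 - y) <= s + ln (ln 2).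
  have s1' : 0 < 1 + s by lra.
  have h : ln (1 - y) <= ln u by rewrite ler_ln ?posrE.
  have -> : 1 + s^-1 = (1 + s) / s by field; rewrite gt_eqF.
  rewrite ln_div ?posrE //; move: h; rewrite /u lnM ?posrE //.
  have h' : ln (1 + s) <= s by apply: le_ln1Dx; lra.
  lra.
have e2 : ln (ln 2) - s <= - ln s + ln (1 - y).
  have u1 : 0 < 1 + u by lra.
  have h : ln (u / (1 + u)) <= ln (1 - y) by rewrite ler_ln ?posrE ?divr_gt0.
  move: h; rewrite ln_div ?posrE // {1}/u lnM ?posrE //.
  have h' : ln (1 + u) <= u by apply: le_ln1Dx; lra.
  lra.
by rewrite ler_norml; apply/andP; split; lra.
Qed.

Lemma npow0 p : npow 0 p = 1 :> R.
Proof. by rewrite /npow oppr0 mul0r expR0. Qed.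

Lemma cvg_npow p : npow n.+1%:R^-1 p @[n --> \oo] --> (npow 0 p : R).
Proof.
rewrite /npow; apply: continuous_cvg; first exact: continuous_expR.
apply: cvgM; last exact: cvg_cst.
by apply: cvgN; exact: cvg_harmonic.
Qed.

Lemma cvg_mertens_gap K : mertens_gap n.+1%:R^-1 K @[n --> \oo] --> (mertens_gap 0 K : R).
Proof.
rewrite /mertens_gap; apply: cvgB.
  apply: cvg_big => [|p pp]; first exact: add_continuous.
  rewrite /euler_log; apply: cvgN; apply: continuous_cvg.
    apply: continuous_ln.
    have [_ _ _ _ h1] := zterm_mult_weight (lexx (0 : R)).
    by rewrite subr_gt0 h1.
  apply: cvgB; first exact: cvg_cst.
  by apply: cvgM; [exact: cvg_npow|exact: cvg_cst].
apply: cvg_big => [|k _]; first exact: add_continuous.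
apply: cvgM; last exact: cvg_cst.
apply: (@continuous_cvg _ _ _ _ _ _ (fun u : R => u ^+ k)); last exact: cvg_npow.
exact: exprn_continuous.
Qed.

(** At fixed K the gap is a finite sum, hence continuous in s. *)
Lemma mertens_gap0_bound : exists2 C : R, 0 <= C & forall K, (0 < K)%N ->
  `|mertens_gap 0 K - ln (ln 2)| <= C / K%:R.
Proof.
have [C C0 HC] := mertens_gap_bound; exists C => // K K0.
have cv : (`|mertens_gap n.+1%:R^-1 K - ln (ln 2)| - n.+1%:R^-1) @[n --> \oo] -->
   `|mertens_gap 0 K - ln (ln 2)| - (0 : R).
  apply: cvgB; last exact: cvg_harmonic.
  by apply: cvg_norm; apply: cvgB; [exact: cvg_mertens_gap|exact: cvg_cst].
rewrite subr0 in cv; apply: (cvgr_to_le cv); apply: nearW => n.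
by rewrite lerBlDl HC // invr_gt0.
Qed.
End Mertens.

(** * Mertens' product theorem *)

Section MertensThird.
Context {R : realType}.
Implicit Types (s x : R) (n m p k K L N : nat).

(** The sequence decreases from index 1 on and stays nonnegative. *)
Lemma cvg_euler_gamma :
  ((\sum_(1 <= k < n.+1) k%:R^-1) - ln n%:R : R) @[n --> \oo] --> euler_gamma R.
Proof.
pose u n : R := (\sum_(1 <= k < n.+1) k%:R^-1) - ln n%:R.
suff /cvg_ex[l] : cvgn [sequence u n.+1]_n.
  by rewrite (cvg_shiftS u) => ul; exact: (cvgP l ul).
apply: nonincreasing_is_cvgn.
  apply/nonincreasing_seqP => n; rewrite /u /= [X in X - _ <= _]big_nat_recr //=.
  by rewrite -addrA lerD2l lerBlDr [leRHS]addrC ln_succ_ge.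
have H n : ln n.+1%:R <= \sum_(1 <= k < n.+1) k%:R^-1 :> R.
  elim: n => [|n IH]; first by rewrite ln1 big_geq.
  rewrite big_nat_recr //=; apply: le_trans (lerD IH (lexx _)).
  by rewrite -lerBlDl ln_succ_le.
exists 0 => _ [n _ <-]; rewrite /u /= subr_ge0.
by apply: le_trans (H n.+1); apply: ler_ln_nat.
Qed.

Lemma euler_factor_primes_upto K :
  expR (- primes_sum (euler_log 0) K) = euler_factor R (primes_upto (2 ^ K)).
Proof.
rewrite /euler_factor /primes_upto big_filter /primes_sum -sumrN expR_sum.
apply: eq_bigr => p pp; rewrite /euler_log opprK /zterm npow0 div1r lnK // posrE.
by have := inv_prime_le R pp; lra.
Qed.

Lemma cvg_inv_nat : (n%:R^-1 : R) @[n --> \oo] --> (0 : R).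
Proof. by rewrite -cvg_shiftS; exact: cvg_harmonic. Qed.

(** At s = 0 the dyadic masses are the terms of the harmonic sum. *)
Lemma mertens_dyadic :
  euler_factor R (primes_upto (2 ^ K)) * (K%:R * ln 2) @[K --> \oo] --> expR (- euler_gamma R).
Proof.
have l2 : 0 < ln 2 :> R by rewrite ln_gt0 // ltr1n.
have [C C0 HC] := @mertens_gap0_bound R.
have cgap : (mertens_gap 0 K : R) @[K --> \oo] --> (ln (ln 2) : R).
  have cC : (C * K%:R^-1 : R) @[K --> \oo] --> (0 : R).
    by rewrite -[X in _ --> X](mulr0 C); apply: cvgM; [exact: cvg_cst|exact: cvg_inv_nat].
  apply: (@squeeze_cvgr _ _ _ _ (fun K => ln (ln 2) - C * K%:R^-1) (fun K => ln (ln 2) + C * K%:R^-1)).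
  - exists 1%N => // K /= K0; have := HC K K0; rewrite ler_norml => /andP[h1 h2].
    by apply/andP; split; lra.
  - by rewrite -[X in _ --> X]subr0; apply: cvgB; [exact: cvg_cst|].
  - by rewrite -[X in _ --> X]addr0; apply: cvgD; [exact: cvg_cst|].
pose w K : R := ln (ln 2) - mertens_gap 0 K
   - ((\sum_(1 <= k < K.+1) k%:R^-1) - ln K%:R) + K%:R^-1.
(* The harmonic sum stops at K - 1; the last term 1/K restores the index K. *)
have cw : w K @[K --> \oo] --> - euler_gamma R.
  have -> : - euler_gamma R = ln (ln 2) - ln (ln 2) - euler_gamma R + 0 by rewrite subrr sub0r addr0.
  apply: cvgD; last exact: cvg_inv_nat.
  apply: cvgB; last exact: cvg_euler_gamma.
  by apply: cvgB; [exact: cvg_cst|].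
have ce : expR (w K) @[K --> \oo] --> expR (- euler_gamma R).
  by apply: continuous_cvg => //; exact: continuous_expR.
apply: cvg_trans ce; apply: near_eq_cvg; exists 1%N => // K /= K0.
have KR : 0 < K%:R :> R by rewrite ltr0n.
rewrite -euler_factor_primes_upto.
rewrite -[K%:R * ln 2]lnK ?posrE ?mulr_gt0 // -expRD lnM ?posrE //; congr expR.
rewrite /w /mertens_gap big_nat_recr //=.
rewrite (eq_bigr (fun k => k%:R^-1)); last first.
  by move=> k _; rewrite /dyadic_mass npow0 expr1n div1r.
by ring.
Qed.

Lemma euler_factor_anti m n : (m <= n)%N ->
  euler_factor R (primes_upto n) <= euler_factor R (primes_upto m).
Proof.
move=> /subnK <-; elim: (n - m)%N => // k IH; apply: le_trans IH.
rewrite addSn primes_uptoS; case: ifP => pp; last by rewrite cats0.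
rewrite /euler_factor big_cat big_seq1 ler_piMr ?gerBl ?invr_ge0 ?ler0n //.
  have /andP[h _] := euler_factor_bounds R (primes_upto_prime (k + m)).
  by apply: le_trans h; rewrite exprn_ge0 // invr_ge0.

Qed.

Lemma cvg_trunc_log_truncn :
  trunc_log 2 (Num.truncn x) @[x --> (+oo : set_system R)] --> \oo.
Proof.
apply/cvgnyPge => A; exists (2 ^ A)%N%:R; split; first exact: num_real.
move=> x /= Ax; apply: trunc_log_max => //.
have Ax' := ltW Ax; have x0 : 0 <= x := le_trans (ler0n _ _) Ax'.
by rewrite truncn_ge_nat.
Qed.

(** With k the binary logarithm of x, both the product and ln x are monotone, so
    the values at x lie between those built from 2^k and 2^(k+1); the resulting
    factors (k + 1) / k tend to 1. *)
Theorem mertens_product :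
  euler_factor R (primes_upto (Num.truncn x)) * ln x @[x --> (+oo : set_system R)]
    --> expR (- euler_gamma R).
Proof.
have l2 : 0 < ln 2 :> R by rewrite ln_gt0 // ltr1n.
pose V k : R := euler_factor R (primes_upto (2 ^ k)).
pose w k : R := V k * (k%:R * ln 2).
have cw : w k @[k --> \oo] --> expR (- euler_gamma R) := mertens_dyadic.
have cwi : w k * k%:R^-1 @[k --> \oo] --> (0 : R).
  by rewrite -[X in _ --> X](mulr0 (expR (- euler_gamma R))); apply: cvgM => //; exact: cvg_inv_nat.
pose up k := w k + w k * k%:R^-1.
have cup : up k @[k --> \oo] --> expR (- euler_gamma R).
  by rewrite -[X in _ --> X]addr0; apply: cvgD.
pose lo k := w k.+1 - w k.+1 * k.+1%:R^-1.
have clo : lo k @[k --> \oo] --> expR (- euler_gamma R).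
  rewrite -[X in _ --> X]subr0; apply: cvgB.
    by have := cw; rewrite -cvg_shiftS.
  by have := cwi; rewrite -cvg_shiftS.
pose kx x := trunc_log 2 (Num.truncn x).
apply: (@squeeze_cvgr _ _ _ _ (lo \o kx) (up \o kx)).
- exists 2; split; first exact: num_real.
  move=> x /= x2; rewrite /up /lo /kx /=.
  set N := Num.truncn x; set k := trunc_log 2 N.
  have x0 : 0 <= x by lra.
  have /andP[Nx xN] := truncn_itv x0; rewrite -/N in Nx xN.
  have N2 : (2 <= N)%N by rewrite truncn_ge_nat // ltW.
  have /andP[kN Nk] : (2 ^ k <= N < 2 ^ k.+1)%N by apply: trunc_log_bounds => //; lia.
  have k0 : (0 < k)%N by rewrite trunc_log_gt0.
  have kR : 0 < k%:R :> R by rewrite ltr0n.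
  have kR1 : 0 < k.+1%:R :> R by rewrite ltr0n.
  have lnE j : ln (2 ^ j)%N%:R = j%:R * ln 2 :> R by rewrite natrX lnXn // mulr_natl.
  have lx1 : k%:R * ln 2 <= ln x.
    rewrite -(lnE k) ler_ln ?posrE ?ltr0n ?expn_gt0 //; last by lra.
    by apply: le_trans Nx; rewrite ler_nat.
  have lx2 : ln x <= k.+1%:R * ln 2.
    rewrite -(lnE k.+1) ler_ln ?posrE ?ltr0n ?expn_gt0 //; last by lra.
    by apply: ltW; apply: lt_le_trans xN _; rewrite ler_nat.
  have V1 : euler_factor R (primes_upto N) <= V k by apply: euler_factor_anti.
  have V2 : V k.+1 <= euler_factor R (primes_upto N) by apply: euler_factor_anti; apply: ltnW.
  have V0 j : 0 <= V j.
    have /andP[h _] := euler_factor_bounds R (primes_upto_prime (2 ^ j)).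
    by apply: le_trans h; rewrite exprn_ge0 // invr_ge0.
  have -> : w k.+1 - w k.+1 / k.+1%:R = V k.+1 * (k%:R * ln 2).
    by rewrite /w -[k.+1%:R]natr1; field; rewrite natr1 gt_eqF.
  have -> : w k + w k / k%:R = V k * (k.+1%:R * ln 2).
    by rewrite /w -[k.+1%:R]natr1; field; rewrite gt_eqF.
  apply/andP; split; apply: ler_pM => //.
    by rewrite mulr_ge0 // ltW.
    exact: le_trans (V0 _) V2.
  by apply: le_trans lx1; rewrite mulr_ge0 // ltW.
- exact: (cvg_comp _ _ cvg_trunc_log_truncn clo).
- exact: (cvg_comp _ _ cvg_trunc_log_truncn cup).
Qed.
End MertensThird.

(** * Pseudosquares *)

Lemma card_pseudosquares (R : realType) (x : R) : 0 <= x ->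
  (#|` fset_set (pseudosquares x `&` `]0%N, primorial x]) |%fset) =
  pseudosquare_count (Num.truncn x).
Proof.
move=> x0; set N := Num.truncn x.
have leN (p : nat) : (p%:R <= x) = (p <= N)%N by rewrite /N truncn_ge_nat.
set L := ((primorial x + 7) %/ 8)%N.
pose P m := all_qr (odd_primes_upto N) (1 + 8 * m) && ~~ is_square (1 + 8 * m).
pose s := [seq (1 + 8 * m)%N | m <- iota 0 L & P m].
have us : uniq s.
  rewrite map_inj_uniq ?filter_uniq ?iota_uniq // => m n; lia.
have -> : pseudosquares x `&` `]0%N, primorial x] = [set` [fset n in s]%fset].
  apply/seteqP; split => n /=.
    case=> -[n0 nsq n1 nqr]; rewrite in_itv /= => /andP[_ nM].
    rewrite inE; apply/mapP; exists (n %/ 8)%N; last first.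
      by have := divn_eq n 8; rewrite n1; lia.
    have nE : (1 + 8 * (n %/ 8) = n)%N by have := divn_eq n 8; rewrite n1 /=; lia.
    rewrite mem_filter mem_iota add0n /= /P nE; apply/andP; split.
      apply/andP; split; last by apply/is_squareP.
      apply/allP => p; rewrite mem_odd_primes_upto => /and3P[pp op pN].
      by apply/eqP; apply: nqr => //; rewrite leN.
    by rewrite ltn_ceil_div8 nE.
  rewrite inE => /mapP[m]; rewrite mem_filter mem_iota add0n /= => /andP[/andP[qr sq] mL] ->.
  split; last first.
    by rewrite in_itv /= leEnat -ltn_ceil_div8.
  split => //.
  - by move=> e; move/is_squareP: sq; apply.
  - by rewrite mulnC addnC modnMDl.
  - move=> p pp op; rewrite leN => pN; apply/eqP; apply: (allP qr).
    by rewrite mem_odd_primes_upto pp op.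
rewrite set_fsetK card_fseq undup_id // size_map size_filter -sum1_count.
rewrite big_mkcond /= -[L in iota 0 L]subn0 big_mkord /pseudosquare_count -/(primorial x) -/L.
by apply: eq_bigr => m _; rewrite /P; case: (_ && _).
Qed.

Lemma cvg_prime_count_factor (R : realType) (c : R) :
  (c / 2 ^+ size (primes_upto (Num.truncn x))) @[x --> (+oo : set_system R)] --> (0 : R).
Proof.
rewrite -[X in _ --> X](mulr0 c); apply: cvgM; first exact: cvg_cst.
have cp : size (primes_upto (Num.truncn x)) @[x --> (+oo : set_system R)] --> \oo.
  apply/cvgnyPge => A; have [N0 hN] := size_primes_upto_unbounded A.
  exists N0%:R; split; first exact: num_real.
  move=> x /= /ltW Nx; apply: hN; rewrite truncn_ge_nat //.
  exact: le_trans Nx.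
have cg : (2^-1 ^+ n : R) @[n --> \oo] --> (0 : R).
  by apply: cvg_expr; rewrite ger0_norm ?invr_ge0 // invf_lt1 // ltr1n.
under eq_fun do rewrite -exprVn.
exact: (cvg_comp _ _ cp cg).
Qed.

Unset Implicit Arguments.

Theorem mainTheorem2 (R : realType) :
  exists2 eps : R -> R, eps x @[x --> +oo] --> (0 : R) &
    \forall x \near +oo,
      (#|` fset_set (pseudosquares x `&` `]0%N, primorial x]) |%fset)%:R =
      (1 + eps x) *
      ((primorial x)%:R / (2 ^+ (prime_pi x).+1 * expR (euler_gamma R) * ln x)).
Proof.
pose S (x : R) : R := (pseudosquare_count (Num.truncn x))%:R.
pose V (x : R) : R := euler_factor R (primes_upto (Num.truncn x)).
pose D (x : R) : R := S x * 2 ^+ (prime_pi x).+1 / ((primorial x)%:R * V x).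
pose eps (x : R) : R := D x * (V x * ln x) * expR (euler_gamma R) - 1.
exists eps.
  have [c c0 hc] := pseudosquare_count_estimate R.
  have cD : D x @[x --> (+oo : set_system R)] --> (1 : R).
    have cc := cvg_prime_count_factor c.
    pose e (x : R) : R := c / 2 ^+ size (primes_upto (Num.truncn x)).
    apply: (@squeeze_cvgr _ _ _ _ (fun x => 1 - e x) (fun x => 1 + e x)).
    - exists 2; split; first exact: num_real.
      move=> x /= /ltW x2; have x0 : 0 <= x by lra.
      have N2 : (2 <= Num.truncn x)%N by rewrite truncn_ge_nat.
      have := hc _ N2; rewrite -/(S x) -/(primorial x) -/(prime_pi x) -/(V x) -/(D x) -/(e x).
      by rewrite ler_norml => /andP[h1 h2]; apply/andP; split; lra.
    - by rewrite -[X in _ --> X]subr0; apply: cvgB; [exact: cvg_cst|].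
    - by rewrite -[X in _ --> X]addr0; apply: cvgD; [exact: cvg_cst|].
  have -> : 0 = 1 * expR (- euler_gamma R) * expR (euler_gamma R) - 1 :> R.
    by rewrite mul1r -expRD addNr expR0 subrr.
  apply: cvgB; last exact: cvg_cst.
  apply: cvgM; last exact: cvg_cst.
  by apply: cvgM => //; exact: mertens_product.
exists 2; split; first exact: num_real.
move=> x /= x2; have x0 : 0 <= x by lra.
rewrite card_pseudosquares // -/(S x) /eps addrC subrK.
have V0 : 0 < V x.
  have /andP[h _] := euler_factor_bounds R (primes_upto_prime (Num.truncn x)).
  by apply: lt_le_trans h; rewrite exprn_gt0 // invr_gt0.
have M0 : 0 < (primorial x)%:R :> R.
  by rewrite ltr0n; exact: prod_primes_gt0 (primes_upto_prime _).
have l0 : 0 < ln x by rewrite ln_gt0 //; lra.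
rewrite /D; have p0 : 0 < 2 ^+ (prime_pi x).+1 :> R by rewrite exprn_gt0.
have e0 := expR_gt0 (euler_gamma R).
by field; rewrite !gt_eqF.
Qed.
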